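(* Any differential form $\omega$ of degree $m$ on a Sasakian manifold $(M^{2n+1},g,\xi)$ can be decomposed as $$\omega=\sum_{0\le b\le\lfloor m/2\rfloor}L^{b}\omega_P^{m-2b},$$ where each $\omega_P^{m-2b}$ is primitive and of degree $m-2b$.
   Context: A Sasakian manifold $(M^{2n+1},g,\xi)$ is a Riemannian manifold of dimension $2n+1$ with a unit Killing vector field $\xi$ such that, with $\eta=\xi^{\flat}$ and $\phi(X):=\nabla_X\xi$ ($\nabla$ the Levi-Civita connection), one has $\phi^2=-I+\eta\otimes\xi$ and $(\nabla_X\phi)(Y)=\eta(Y)X-g(X,Y)\xi$ for all vector fields $X,Y$. Forms are smooth and complex-valued. $L=\tfrac12\,d\eta\wedge$ on forms, $\Lambda=L^{\ast}$ is its adjoint with respect to the Hermitian inner product on forms, and a form $\omega$ is primitive if $\Lambda\omega=0$. *)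

(* Defs.v *)
From mathcomp Require Import all_boot all_order all_algebra all_fingroup.
From mathcomp Require Import complex.
From mathcomp Require Import all_classical all_reals topology normedtype derive.
Import Order.TTheory GRing.Theory Num.Theory.
Import numFieldNormedType.Exports.
Set Implicit Arguments.
Unset Strict Implicit.
Unset Printing Implicit Defensive.
Local Open Scope classical_set_scope.
Local Open Scope complex_scope.
Local Open Scope ring_scope.

(* Vectors are row vectors, and linear maps act on them on the right: a tangent
   vector v at x is sent by a map f to v *m jacobian f x.  A k-tuple of vectors
   of R^d is a k x d matrix, so k-multilinear forms on R^d are functions on
   'M[R]_(k, d), and f acts on k-tuples by A |-> A *m jacobian f x. *)

(* Meant for an open set U.  C^(k+1) is "differentiable with C^k directional
   derivatives", so that C^k has its usual meaning on finite-dimensional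
   spaces. *)
Fixpoint is_Ck (R : realType) (V W : normedModType R) (k : nat) (U : set V)
    (f : V -> W) : Prop :=
  if k is k'.+1 then
    (forall x, U x -> differentiable f x) /\
    (forall v, is_Ck k' U (fun x => 'D_v f x))
  else {in U, continuous f}.

Definition smooth_on (R : realType) (V W : normedModType R) (U : set V)
    (f : V -> W) : Prop :=
  forall k, is_Ck k U f.

Record chart (R : realType) (d : nat) (M : topologicalType) := Chart {
  chart_dom : set M;
  chart_map :> M -> 'rV[R]_d;
  chart_inv : 'rV[R]_d -> M;
  chart_dom_open : open chart_dom;
  chart_im_open : open [set chart_map p | p in chart_dom];
  chart_mapK : {in chart_dom, cancel chart_map chart_inv};
  chart_map_cont : {in chart_dom, continuous chart_map};
  chart_inv_cont :
    {in [set chart_map p | p in chart_dom], continuous chart_inv} }.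

Definition chart_im (R : realType) (d : nat) (M : topologicalType)
    (c : chart R d M) : set 'rV[R]_d :=
  [set c p | p in chart_dom c].

Definition overlap (R : realType) (d : nat) (M : topologicalType)
    (c c' : chart R d M) : set 'rV[R]_d :=
  [set c p | p in chart_dom c `&` chart_dom c'].

Definition transition (R : realType) (d : nat) (M : topologicalType)
    (c c' : chart R d M) : 'rV[R]_d -> 'rV[R]_d :=
  fun x => c' (chart_inv c x).

Record manifold (R : realType) (d : nat) := Manifold {
  mf_space :> topologicalType;
  mf_hausdorff : hausdorff_space mf_space;
  mf_second_countable : @second_countable mf_space;
  mf_index : Type;
  mf_atlas : mf_index -> chart R d mf_space;
  mf_cover : forall p : mf_space, exists i, chart_dom (mf_atlas i) p;
  mf_compat : forall i j,
    smooth_on (overlap (mf_atlas i) (mf_atlas j))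
              (transition (mf_atlas i) (mf_atlas j)) }.

Section Manifold.
Variables (R : realType) (d : nat) (M : manifold R d).

(* The range of the i-th chart, the set of points whose i-th and j-th
   coordinates are both defined (in i-th coordinates), and the change of
   coordinates with its Jacobian. *)
Definition cim (i : mf_index M) : set 'rV[R]_d := chart_im (mf_atlas i).
Definition covl (i j : mf_index M) : set 'rV[R]_d :=
  overlap (mf_atlas i) (mf_atlas j).
Definition cchange (i j : mf_index M) : 'rV[R]_d -> 'rV[R]_d :=
  transition (mf_atlas i) (mf_atlas j).
Definition cjac (i j : mf_index M) (x : 'rV[R]_d) : 'M[R]_d :=
  jacobian (cchange i j) x.

(* A tensor field is given by its components in the charts of the atlas, as
   functions of the coordinates, subject to the transformation law; the values
   off the range of a chart are irrelevant. *)

Record vector_field := VectorField {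
  vf_comp :> mf_index M -> 'rV[R]_d -> 'rV[R]_d;
  vf_smooth : forall i, smooth_on (cim i) (vf_comp i);
  vf_transf : forall i j x, covl i j x ->
    vf_comp j (cchange i j x) = vf_comp i x *m cjac i j x }.

(* g(v, w) is v *m g *m w^T. *)
Record metric := Metric {
  met_comp :> mf_index M -> 'rV[R]_d -> 'M[R]_d;
  met_smooth : forall i, smooth_on (cim i) (met_comp i);
  met_sym : forall i x, cim i x -> (met_comp i x)^T = met_comp i x;
  met_pos : forall i x, cim i x -> forall v : 'rV[R]_d, v != 0 ->
    0 < (v *m met_comp i x *m v^T) 0 0;
  met_transf : forall i j x, covl i j x ->
    met_comp i x = cjac i j x *m met_comp j (cchange i j x) *m (cjac i j x)^T }.

(* Alternating R-multilinear maps (R^d)^k -> C. *)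
Definition altform (k : nat) (f : 'M[R]_(k, d) -> R[i]) : Prop :=
  (forall (A B C : 'M[R]_(k, d)) (i0 : 'I_k) (b c : R),
     row i0 A = b *: row i0 B + c *: row i0 C ->
     row' i0 B = row' i0 A -> row' i0 C = row' i0 A ->
     f A = b%:C * f B + c%:C * f C) /\
  (forall (A : 'M[R]_(k, d)) (i1 i2 : 'I_k),
     i1 != i2 -> row i1 A = row i2 A -> f A = 0).

Record diff_form (k : nat) := DiffForm {
  df_comp :> mf_index M -> 'rV[R]_d -> 'M[R]_(k, d) -> R[i];
  df_alt : forall i x, cim i x -> altform (df_comp i x);
  df_smooth : forall i (A : 'M[R]_(k, d)),
    smooth_on (cim i) (fun x => complex.Re (df_comp i x A)) /\
    smooth_on (cim i) (fun x => complex.Im (df_comp i x A));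
  df_transf : forall i j x, covl i j x -> forall A : 'M[R]_(k, d),
    df_comp i x A = df_comp j (cchange i j x) (A *m cjac i j x) }.

End Manifold.

Section LocalGeometry.
Variables (R : realType) (d : nat).
Implicit Types (g : 'rV[R]_d -> 'M[R]_d) (xi Y : 'rV[R]_d -> 'rV[R]_d).

(* g(v, w) for the Gram matrix G of g at the point. *)
Definition gdot (G : 'M[R]_d) (v w : 'rV[R]_d) : R := (v *m G *m w^T) 0 0.

Definition basis_vec (a : 'I_d) : 'rV[R]_d := delta_mx 0 a.

(* Gamma^k_(ab) for the Levi-Civita connection. *)
Definition christoffel g (x : 'rV[R]_d) (a b k : 'I_d) : R :=
  2^-1 * \sum_(l < d) invmx (g x) k l *
    ('D_(basis_vec a) (fun y => g y b l) x
     + 'D_(basis_vec b) (fun y => g y a l) x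
     - 'D_(basis_vec l) (fun y => g y a b) x).

(* (nabla_v Y)(x). *)
Definition nabla g (v : 'rV[R]_d) Y (x : 'rV[R]_d) : 'rV[R]_d :=
  'D_v Y x
  + \row_k \sum_(a < d) \sum_(b < d) v 0 a * Y x 0 b * christoffel g x a b k.

(* (L_xi g)(v, w) = xi(g(v, w)) - g([xi, v], w) - g(v, [xi, w]) at x, for v and
   w extended with constant components, in which case [xi, v] = - 'D_v xi. *)
Definition lie_metric g xi (x v w : 'rV[R]_d) : R :=
  'D_(xi x) (fun y => gdot (g y) v w) x
  + gdot (g x) ('D_v xi x) w + gdot (g x) v ('D_w xi x).

(* eta = xi^flat, a 1-form since 'rV_d is 'M_(1, d). *)
Definition eta g xi (x : 'rV[R]_d) (v : 'rV[R]_d) : R := gdot (g x) v (xi x).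

Definition phi g xi (x v : 'rV[R]_d) : 'rV[R]_d := nabla g v xi x.

(* Exterior derivative, normalised by
   d alpha(X, Y) = X(alpha(Y)) - Y(alpha(X)) - alpha([X, Y]) on 1-forms. *)
Definition ext_deriv (k : nat) (w : 'rV[R]_d -> 'M[R]_(k, d) -> R)
    (x : 'rV[R]_d) (A : 'M[R]_(k.+1, d)) : R :=
  \sum_(j < k.+1) (-1) ^+ j * 'D_(row j A) (fun y => w y (row' j A)) x.

Definition wedge (p q : nat) (a : 'M[R]_(p, d) -> R[i])
    (b : 'M[R]_(q, d) -> R[i]) (A : 'M[R]_(p + q, d)) : R[i] :=
  (p`! * q`!)%:R^-1 *
  \sum_(s : 'S_(p + q))
     (-1) ^+ s * a (usubmx (row_perm s A)) * b (dsubmx (row_perm s A)).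

(* L at the point x. *)
Definition lefschetz g xi (x : 'rV[R]_d) (k : nat)
    (a : 'M[R]_(k, d) -> R[i]) : 'M[R]_(2 + k, d) -> R[i] :=
  wedge (fun B : 'M[R]_(2, d) => (2^-1 * ext_deriv (eta g xi) x B)%:C) a.

Fixpoint lefschetz_iter g xi (x : 'rV[R]_d) (k b : nat)
    (a : 'M[R]_(k, d) -> R[i]) : 'M[R]_(b.*2 + k, d) -> R[i] :=
  match b return 'M[R]_(b.*2 + k, d) -> R[i] with
  | 0 => a
  | b'.+1 => lefschetz g xi x (@lefschetz_iter g xi x k b' a)
  end.

(* Hermitian inner product on alternating k-forms induced by the Gram matrix G:
   the full contraction with the inverse metric divided by k!, for which the
   e^(i_1) /\ ... /\ e^(i_k) with i_1 < ... < i_k are orthonormal if the e_i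
   are. *)
Definition form_dot (G : 'M[R]_d) (k : nat) (a b : 'M[R]_(k, d) -> R[i]) :
    R[i] :=
  k`!%:R^-1 *
  \sum_(I : {ffun 'I_k -> 'I_d}) \sum_(J : {ffun 'I_k -> 'I_d})
     (\prod_(r < k) invmx G (I r) (J r))%:C
     * a (rowsub I 1%:M) * (b (rowsub J 1%:M))^*.

(* Lambda = L^* at the point x: Lambda w is the alternating form b such that
   <L a, w> = <a, b> for all alternating a.  It lowers the degree by 2, hence
   vanishes on forms of degree 0 and 1. *)
Definition lambda_op g xi (x : 'rV[R]_d) (k : nat) :
    ('M[R]_(k, d) -> R[i]) -> 'M[R]_(k.-2, d) -> R[i] :=
  match k with
  | k'.+2 => fun w =>
      xget 0 [set b : 'M[R]_(k', d) -> R[i] | altform b /\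
        forall a : 'M[R]_(k', d) -> R[i], altform a ->
          form_dot (g x) (lefschetz g xi x a) w = form_dot (g x) a b]
  | _ => fun _ _ => 0
  end.

End LocalGeometry.

(* In [sas_nabla_phi] Y ranges over the smooth vector fields on a coordinate
   domain; the identity is tensorial in X = v and Y, so this amounts to
   quantifying over the vector fields of M. *)
Record sasakian (R : realType) (n : nat) := Sasakian {
  sas_mf :> manifold R n.*2.+1;
  sas_g : metric sas_mf;
  sas_xi : vector_field sas_mf;
  sas_unit : forall i x, cim i x -> gdot (sas_g i x) (sas_xi i x) (sas_xi i x) = 1;
  sas_killing : forall i x, cim i x -> forall v w,
    lie_metric (sas_g i) (sas_xi i) x v w = 0;
  sas_phi2 : forall i x, cim i x -> forall v,
    phi (sas_g i) (sas_xi i) x (phi (sas_g i) (sas_xi i) x v)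
    = - v + eta (sas_g i) (sas_xi i) x v *: sas_xi i x;
  sas_nabla_phi : forall i x, cim i x ->
    forall (v : 'rV[R]_(n.*2.+1)) (Y : 'rV[R]_(n.*2.+1) -> 'rV[R]_(n.*2.+1)),
    smooth_on (cim i) Y ->
    nabla (sas_g i) v (fun y => phi (sas_g i) (sas_xi i) y (Y y)) x
    - phi (sas_g i) (sas_xi i) x (nabla (sas_g i) v Y x)
    = eta (sas_g i) (sas_xi i) x (Y x) *: v
      - gdot (sas_g i x) v (Y x) *: sas_xi i x }.

Section Sasakian.
Variables (R : realType) (n : nat) (S : sasakian R n).

(* L^b on forms of degree k, as a form of degree m = 2b + k. *)
Definition Lpow (b k m : nat) (e : (b.*2 + k)%N = m) (w : diff_form S k)
    (i : mf_index S) (x : 'rV[R]_(n.*2.+1)) (A : 'M[R]_(m, n.*2.+1)) : R[i] :=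
  lefschetz_iter (b := b) (sas_g S i) (sas_xi S i) x (w i x)
    (castmx (esym e, erefl) A).

Definition Lambda (k : nat) (w : diff_form S k) (i : mf_index S)
    (x : 'rV[R]_(n.*2.+1)) : 'M[R]_(k.-2, n.*2.+1) -> R[i] :=
  lambda_op (sas_g S i) (sas_xi S i) x (w i x).

Definition primitive (k : nat) (w : diff_form S k) : Prop :=
  forall i x, cim i x -> forall A, Lambda w i x A = 0.

End Sasakian.

Lemma lefschetz_degree (m : nat) (b : 'I_(m./2.+1)) :
  (b.*2 + (m - b.*2))%N = m.
Proof.
apply: subnKC; apply: leq_trans (_ : m./2.*2 <= m)%N.
  by rewrite leq_double -ltnS.
by rewrite -[leqRHS]odd_double_half leq_addl.
Qed.

(* Main.v *)
(* On each tangent space phi is a complex structure on xi^perp, so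
   on k-forms [Lambda, L] = n - k + P, where P = eta /\ iota_xi is a projection
   commuting with L and Lambda.  Split w = P w + (w - P w), so that P acts by a
   scalar e, and induct on the degree m of w.  If Lambda w = sum_b L^b q_b with
   q_b primitive, then Lambda L^(b+1) q_b = c_b L^b q_b for the constant
   c_b = (b + 1) (n - m + 2 + b + e), so p = w - sum_b c_b^-1 L^(b+1) q_b is
   primitive up to the term with c_b = 0; in that case p = 0 because L is
   nilpotent.  All coefficients are constants, so smoothness and independence of
   the chart come for free from those of L, Lambda and P.  The latter require
   that d eta is a tensor, hence the symmetry of second derivatives, and that
   d eta = 2 g(phi _, _), which is the Killing equation. *)

Require Import Defs.
From mathcomp Require Import all_boot all_order all_algebra all_fingroup.
From mathcomp Require Import complex ring.
From mathcomp Require Import all_classical all_reals topology normedtype.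
From mathcomp Require Import landau derive.
Import Order.TTheory GRing.Theory Num.Theory.
Import numFieldNormedType.Exports.
Set Implicit Arguments.
Unset Strict Implicit.
Unset Printing Implicit Defensive.
Local Open Scope classical_set_scope.
Local Open Scope complex_scope.
Local Open Scope ring_scope.

(** * Alternating forms as functions on lists *)

(** With [P = e] the number [n - k + e] is an sl2 weight, lowered by 2 under [L]. Adding the weights
    along a tower gives [Lambda L^(j+1) q = (j + 1)(n - k + e - j) L^j q] for [q] primitive of
    degree [k]; [c_b] is the case [k = m - 2 - 2b], [j = b]. At most one [c_b] vanishes. There [q_b]
    has weight exactly [b], so [L^(b+1) q_b] is killed by [Lambda] while its weight [-(b + 2)] is
    negative. A nonzero form of this kind would have an infinite [L]-tower, so [L^(b+1) q_b = 0].
    Hence [L Lambda p = 0] with [p] of the same negative weight, and the same argument gives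
    [p = 0]. The Hermitian product enters only through the definition of [Lambda], which chooses at
    each point some form satisfying the adjunction. To compute with it, differentiate it and change
    charts, it is identified with the contraction by the bivector [T = g^-1 O g^-1], where [O] is
    the matrix of [d eta / 2]: this contraction is an adjoint, and nondegeneracy leaves no other. *)

Section ListForms.
Variables (R : rcfType) (d : nat).
Local Notation V := 'rV[R]_d.
Local Notation C := R[i].
Implicit Types (F : seq V -> C) (c : 'cV[R]_d) (O : 'M[R]_d) (s : seq V).

(* A k-form is a function F on lists of vectors vanishing on lists of length
   other than k; this frees the operators below from dependent degrees, and
   makes them satisfy their (anti)commutation rules by structural recursion. *)
Definition pairing (v : V) c : C := ((v *m c) 0 0)%:C.

Definition contract (v : V) F : seq V -> C := fun s => F (v :: s).

(* Exterior product with the 1-form c. *)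
Fixpoint ext c F s : C :=
  if s is v :: s' then pairing v c * F s' - ext c (contract v F) s' else 0.

(* Exterior product with the 2-form of matrix O, defined by
   iota_v (O /\ F) = O /\ iota_v F + (iota_v O) /\ F. *)
Fixpoint lef O F s : C :=
  if s is v :: s' then lef O (contract v F) s' + ext (v *m O)^T F s' else 0.

(* Contraction with the bivector of matrix T. *)
Definition lam (T : 'M[R]_d) F s : C :=
  2^-1 * \sum_a \sum_b (T a b)%:C * F [:: delta_mx 0 a, delta_mx 0 b & s].

Definition multilinear F := forall s1 u v (r : R) s2,
  F (s1 ++ (u + r *: v) :: s2) = F (s1 ++ u :: s2) + r%:C * F (s1 ++ v :: s2).

(** Only neighbours are compared, a pattern that the recursions of [ext] and [lef] can check; with
    [multilinear] it yields swaps and then arbitrary repetitions. *)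
Definition alternating F := forall s1 u s2, F (s1 ++ u :: u :: s2) = 0.

Definition homogeneous k F := forall s, size s != k -> F s = 0.

Lemma pairingD v c c' (r : R) :
  pairing v (c + r *: c') = pairing v c + r%:C * pairing v c'.
Proof. by rewrite /pairing mulmxDr -scalemxAr !mxE rmorphD rmorphM. Qed.

Lemma pairingDl u v (r : R) c :
  pairing (u + r *: v) c = pairing u c + r%:C * pairing v c.
Proof. by rewrite /pairing mulmxDl -scalemxAl !mxE rmorphD rmorphM. Qed.

Lemma extD c F G (x : C) s :
  ext c (fun t => F t + x * G t) s = ext c F s + x * ext c G s.
Proof.
elim: s F G => [|v s IH] F G /=; first by rewrite mulr0 addr0.
by rewrite (IH (contract v F) (contract v G)); ring.
Qed.

Lemma ext0 c s : ext c (fun=> 0) s = 0.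
Proof. by elim: s => //= v s IH; rewrite mulr0 IH subr0. Qed.

Lemma ext_sum c I (r : seq I) (x : I -> C) (H : I -> seq V -> C) s :
  ext c (fun t => \sum_(i <- r) x i * H i t) s
  = \sum_(i <- r) x i * ext c (H i) s.
Proof.
elim: r => [|i r IH].
  rewrite big_nil -[RHS](ext0 c s); congr ext.
  by apply: funext => t; rewrite big_nil.
rewrite big_cons -IH addrC -extD; congr ext.
by apply: funext => t; rewrite big_cons addrC.
Qed.

Lemma extB c F G s :
  ext c (fun t => F t - G t) s = ext c F s - ext c G s.
Proof.
rewrite -[in RHS]mulN1r -extD; congr ext.
by apply: funext => t; rewrite mulN1r.
Qed.

Lemma extZ c F (x : C) s : ext c (fun t => x * F t) s = x * ext c F s.
Proof.
have := extD c (fun=> 0) F x s; rewrite ext0 add0r => <-.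
by congr ext; apply: funext => t; rewrite add0r.
Qed.

Lemma extDl c c' (r : R) F s :
  ext (c + r *: c') F s = ext c F s + r%:C * ext c' F s.
Proof.
elim: s F => [|v s IH] F /=; first by rewrite mulr0 addr0.
by rewrite pairingD IH; ring.
Qed.

Lemma ext0l F s : ext 0 F s = 0.
Proof.
by elim: s F => //= v s IH F; rewrite IH /pairing mulmx0 mxE mul0r subr0.
Qed.

Lemma ext_suml I (r : seq I) (x : I -> R) (c : I -> 'cV[R]_d) F s :
  ext (\sum_(i <- r) x i *: c i) F s = \sum_(i <- r) (x i)%:C * ext (c i) F s.
Proof.
elim: r => [|i r IH]; first by rewrite !big_nil ext0l.
by rewrite !big_cons -IH addrC extDl addrC.
Qed.

(** Contracting by the head [v] gives two terms with a single pairing, which change sign when [c]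
    and [c'] are exchanged, and a double product on the tail, left to the induction. *)
Lemma ext_anti c c' F s : ext c (ext c' F) s = - ext c' (ext c F) s.
Proof.
elim: s F => [|v s IH] F /=; first by rewrite oppr0.
rewrite /contract /= !extB !extZ IH; ring.
Qed.

Lemma ext_ext0 c F s : ext c (ext c F) s = 0.
Proof.
have /eqP := ext_anti c c F s; rewrite -addr_eq0 -mulr2n -mulr_natl.
by rewrite mulf_eq0 pnatr_eq0 /= => /eqP.
Qed.

Lemma lefD O F G (x : C) s :
  lef O (fun t => F t + x * G t) s = lef O F s + x * lef O G s.
Proof.
elim: s F G => [|v s IH] F G /=; first by rewrite mulr0 addr0.
by rewrite (IH (contract v F) (contract v G)) extD; ring.
Qed.

Lemma lef0 O s : lef O (fun=> 0) s = 0.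
Proof. by elim: s => //= v s IH; rewrite IH ext0 addr0. Qed.

Lemma lefB O F G s : lef O (fun t => F t - G t) s = lef O F s - lef O G s.
Proof.
rewrite -[in RHS]mulN1r -lefD; congr lef.
by apply: funext => t; rewrite mulN1r.
Qed.

Lemma lefZ O F (x : C) s : lef O (fun t => x * F t) s = x * lef O F s.
Proof.
have := lefD O (fun=> 0) F x s; rewrite lef0 add0r => <-.
by congr lef; apply: funext => t; rewrite add0r.
Qed.

Lemma lef_sum O I (r : seq I) (x : I -> C) (H : I -> seq V -> C) s :
  lef O (fun t => \sum_(i <- r) x i * H i t) s
  = \sum_(i <- r) x i * lef O (H i) s.
Proof.
elim: r => [|i r IH].
  rewrite big_nil -[RHS](lef0 O s); congr lef.
  by apply: funext => t; rewrite big_nil.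
rewrite big_cons -IH addrC -lefD; congr lef.
by apply: funext => t; rewrite big_cons addrC.
Qed.

Lemma ext_lef O c F s : ext c (lef O F) s = lef O (ext c F) s.
Proof.
elim: s F => [//|v s IH] F /=.
have -> : contract v (lef O F)
    = fun t => lef O (contract v F) t + 1 * ext (v *m O)^T F t.
  by apply: funext => t; rewrite mul1r.
rewrite extD (IH (contract v F)) /contract /= lefB lefZ.
by rewrite (ext_anti (v *m O)^T); ring.
Qed.

Lemma multilinear_contract v F : multilinear F -> multilinear (contract v F).
Proof. by move=> mF s1; exact: (mF (v :: s1)). Qed.

Lemma alternating_contract v F : alternating F -> alternating (contract v F).
Proof. by move=> mF s1; exact: (mF (v :: s1)). Qed.

Lemma homogeneous_contract k v F :
  homogeneous k.+1 F -> homogeneous k (contract v F).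
Proof. by move=> hF s sk; apply: hF. Qed.

Lemma contract_homogeneous0 v F : homogeneous 0 F -> contract v F = fun=> 0.
Proof. by move=> hF; apply: funext => s; apply: hF. Qed.

Lemma multilinear_ext c F : multilinear F -> multilinear (ext c F).
Proof.
move=> mF s1; elim: s1 F mF => [|w s1 IH] F mF u v r s2 /=.
  rewrite pairingDl.
  have -> : contract (u + r *: v) F
      = fun t => contract u F t + r%:C * contract v F t.
    by apply: funext => t; exact: (mF [::]).
  by rewrite extD; ring.
by rewrite mF IH; [ring | exact: multilinear_contract].
Qed.

Lemma alternating_ext c F : alternating F -> alternating (ext c F).
Proof.
move=> aF s1; elim: s1 F aF => [|w s1 IH] F aF u s2 /=.
  have -> : contract u (contract u F) = fun=> 0.
    by apply: funext => t; exact: (aF [::]).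
  by rewrite ext0 /contract; ring.
by rewrite aF IH; [ring | exact: alternating_contract].
Qed.

Lemma homogeneous_ext k c F : homogeneous k F -> homogeneous k.+1 (ext c F).
Proof.
move=> hF s; elim: s k F hF => [//|v s IH] k F hF /=; rewrite eqSS => sk.
rewrite hF // mulr0 sub0r; case: k hF sk => [|k] hF sk.
  by rewrite contract_homogeneous0 // ext0 oppr0.
by rewrite (IH k) ?oppr0 //; exact: homogeneous_contract.
Qed.

Lemma multilinear_lef O F : multilinear F -> multilinear (lef O F).
Proof.
move=> mF s1; elim: s1 F mF => [|w s1 IH] F mF u v r s2 /=.
  have -> : contract (u + r *: v) F
      = fun t => contract u F t + r%:C * contract v F t.
    by apply: funext => t; exact: (mF [::]).
  rewrite lefD mulmxDl -scalemxAl linearD linearZ /= extDl; ring.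
rewrite IH; last exact: multilinear_contract.
by rewrite (multilinear_ext _ mF); ring.
Qed.

Lemma pairing_skew O (u v : V) : O^T = - O ->
  pairing v (u *m O)^T = - pairing u (v *m O)^T.
Proof.
move=> sO; rewrite /pairing -rmorphN.
suff -> : (v *m (u *m O)^T) 0 0 = - (u *m (v *m O)^T) 0 0 by [].
transitivity ((v *m (u *m O)^T)^T 0 0); first by rewrite [RHS]mxE.
by rewrite trmx_mul trmxK trmx_mul sO mulNmx mulmxN mulmxA [in RHS]mxE opprK.
Qed.

Lemma pairing_skew_diag O (v : V) : O^T = - O -> pairing v (v *m O)^T = 0.
Proof.
move=> sO; have /eqP := pairing_skew v v sO.
by rewrite -addr_eq0 -mulr2n -mulr_natl mulf_eq0 pnatr_eq0 /= => /eqP.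
Qed.

(** On two equal heads [u, u] the two products with [iota_u O] cancel, and the remaining number
    [u O u^T] is zero because [O] is skew. *)
Lemma alternating_lef O F :
  O^T = - O -> alternating F -> alternating (lef O F).
Proof.
move=> sO aF s1; elim: s1 F aF => [|w s1 IH] F aF u s2 /=.
  have -> : contract u (contract u F) = fun=> 0.
    by apply: funext => t; exact: (aF [::]).
  by rewrite lef0 pairing_skew_diag //; ring.
rewrite IH; last exact: alternating_contract.
by rewrite (alternating_ext _ aF) addr0.
Qed.

Lemma homogeneous_lef k O F : homogeneous k F -> homogeneous k.+2 (lef O F).
Proof.
move=> hF s; elim: s k F hF => [//|v s IH] k F hF /=; rewrite eqSS => sk.
rewrite (homogeneous_ext _ hF) // addr0; case: k hF sk => [|k] hF sk.
  by rewrite contract_homogeneous0 // lef0.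
by rewrite (IH k) //; exact: homogeneous_contract.
Qed.

Lemma multilinear_scale F s1 (r : R) v s2 : multilinear F ->
  F (s1 ++ (r *: v) :: s2) = r%:C * F (s1 ++ v :: s2).
Proof.
move=> mF; have F0 : F (s1 ++ 0 :: s2) = 0.
  have := mF s1 0 0 1 s2; rewrite scaler0 addr0 mul1r => /eqP.
  by rewrite -subr_eq0 opprD addrA subrr sub0r oppr_eq0 => /eqP.
by rewrite -[r *: v]add0r mF F0 add0r.
Qed.

Lemma multilinear_sum F s1 I (r : seq I) (x : I -> R) (v : I -> V) s2 :
  multilinear F ->
  F (s1 ++ (\sum_(i <- r) x i *: v i) :: s2)
  = \sum_(i <- r) (x i)%:C * F (s1 ++ v i :: s2).
Proof.
move=> mF; elim: r => [|i r IH].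
  by rewrite !big_nil -[0](scale0r 0) multilinear_scale // mul0r.
by rewrite !big_cons addrC mF IH addrC.
Qed.

Lemma multilinear_basis F s1 v s2 : multilinear F ->
  F (s1 ++ v :: s2) = \sum_b (v 0 b)%:C * F (s1 ++ delta_mx 0 b :: s2).
Proof. by move=> mF; rewrite {1}[v]row_sum_delta multilinear_sum. Qed.

Lemma multilinearD F s1 u v s2 : multilinear F ->
  F (s1 ++ (u + v) :: s2) = F (s1 ++ u :: s2) + F (s1 ++ v :: s2).
Proof. by move=> mF; rewrite -[v]scale1r mF mul1r scale1r. Qed.

Lemma alternating_swap F s1 u v s2 : multilinear F -> alternating F ->
  F (s1 ++ u :: v :: s2) = - F (s1 ++ v :: u :: s2).
Proof.
move=> mF aF; have := aF s1 (u + v) s2.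
have E w : F (s1 ++ [:: w, u + v & s2])
    = F (s1 ++ [:: w, u & s2]) + F (s1 ++ [:: w, v & s2]).
  by rewrite -!(cat_rcons w) multilinearD.
rewrite (multilinearD s1 u v _ mF) !E.
by rewrite !aF add0r addr0 => /eqP; rewrite addr_eq0 => /eqP.
Qed.

Lemma alternating_repeat F s1 u s2 s3 : multilinear F -> alternating F ->
  F (s1 ++ u :: s2 ++ u :: s3) = 0.
Proof.
move=> mF aF; elim: s2 s1 => [|v s2 IH] s1 /=; first exact: aF.
by rewrite alternating_swap // -cat_rcons IH oppr0.
Qed.

(** Expanding every entry in the basis leaves only lists of more than [d] basis vectors, in which
    some vector occurs twice. *)
Lemma homogeneous_ge_dim k F s : multilinear F -> alternating F ->
  homogeneous k F -> (d < k)%N -> F s = 0.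
Proof.
move=> mF aF hF dk; have [ks|] := eqVneq (size s) k; last exact: hF.
(* [l] records the basis vectors already substituted, [t] the entries still to be expanded. *)
suff key t (l : seq 'I_d) : (size l + size t)%N = k ->
    F ([seq delta_mx 0 i | i <- l] ++ t) = 0 by exact: (key s [::]).
elim: t l => [|v t IH] l; last first.
  rewrite multilinear_basis // => /= lk; rewrite big1 // => b _.
  by rewrite -cat_rcons -map_rcons IH ?mulr0 // size_rcons addSnnS.
rewrite addn0 cats0 => lk; have [lu|/uniqPn] := boolP (uniq l).
  have := max_card (mem l); rewrite card_ord.
  by rewrite (card_uniqP lu) lk leqNgt dk.
have i0 : 'I_d by move: dk; rewrite -lk; case: (l).
move=> /(_ i0) [i [j [ij jl eij]]].
have -> : l = take i l ++ nth i0 l i ::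
    take (j - i.+1) (drop i.+1 l) ++ nth i0 l i :: drop j.+1 l.
  rewrite -{1}(cat_take_drop i l); congr cat.
  rewrite (drop_nth i0) ?(ltn_trans ij) //; congr cons.
  rewrite -{1}(cat_take_drop (j - i.+1) (drop i.+1 l)); congr cat.
  by rewrite drop_drop subnK // (drop_nth i0) // eij.
by rewrite map_cat /= map_cat /= alternating_repeat.
Qed.

End ListForms.

(** * The commutator of a 2-form and a bivector, for arbitrary skew matrices *)

Section Sl2.
Variables (R : rcfType) (d : nat).
Local Notation V := 'rV[R]_d.
Local Notation C := R[i].
Implicit Types (F : seq V -> C) (c : 'cV[R]_d) (O T : 'M[R]_d) (s : seq V).

Lemma pairing_delta_l b (c : 'cV[R]_d) : pairing (delta_mx 0 b) c = (c b 0)%:C.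
Proof. by rewrite /pairing -rowE mxE. Qed.

Lemma pairing_delta_r (v : V) b : pairing v (delta_mx b 0) = (v 0 b)%:C.
Proof. by rewrite /pairing -colE mxE. Qed.

(** A 2-form is half the sum of the [e^b /\ iota_(e_b) O]. Written with 1-forms only, [lef] comes
    within reach of [ip_ext] and [ext_rows]. *)
Lemma lefE O F s : O^T = - O -> multilinear F -> 
  2 * lef O F s
  = \sum_b ext (delta_mx b 0) (ext (delta_mx 0 b *m O)^T F) s.
Proof.
move=> sO; elim: s F => [|v s IH] F mF /=.
  by rewrite mulr0 big1.
rewrite mulrDr IH; last exact: multilinear_contract.
under [in RHS]eq_bigr => b _.
  have -> : contract v (ext (delta_mx 0 b *m O)^T F) = fun t =>
      pairing v (delta_mx 0 b *m O)^T * F t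
      - ext (delta_mx 0 b *m O)^T (contract v F) t by [].
  rewrite extB extZ pairing_delta_r (pairing_skew _ _ sO) pairing_delta_l.
  over.
(* Contracting by [v] produces the 1-form [iota_v O] twice, once from each factor, the second time
   through skewness; [Ev] and [Ew] are the two expansions needed. *)
have Ev : (v *m O)^T = \sum_b v 0 b *: (delta_mx 0 b *m O)^T.
  rewrite {1}[v]row_sum_delta mulmx_suml linear_sum /=.
  by apply: eq_bigr => b _; rewrite -scalemxAl linearZ.
have Ew : (v *m O)^T = \sum_b (v *m O)^T b 0 *: delta_mx b 0.
  rewrite {1}[v *m O]row_sum_delta linear_sum; apply: eq_bigr => b _ /=.
  by rewrite linearZ /= trmx_delta [in RHS]mxE.
rewrite -[LHS]addrC [2 * _]mulr_natl [_ *+ 2]mulr2n -addrA.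
rewrite {1}Ev {1}Ew !ext_suml -!big_split /=.
by apply: eq_bigr => b _; ring.
Qed.

(** Contracting [O /\ F] by [e_a] and [e_b] gives [O /\ iota iota F], the number [O a b] times [F],
    and two cross terms. These agree after exchanging indices ([XN]), which absorbs the factor 1/2;
    their sum is, up to sign, the derivation of the exterior algebra induced by the endomorphism
    [T^T *m O]. *)
Lemma lam_lef O T F s : T^T = - T ->
  lam T (lef O F) s = lef O (lam T F) s
  + 2^-1 * \sum_a \sum_b (T a b * O a b)%:C * F s
  - \sum_b ext (row b (T^T *m O))^T (contract (delta_mx 0 b) F) s.
Proof.
move=> sT; pose e a : V := delta_mx 0 a.
pose X a b := (T a b)%:C * ext (e a *m O)^T (contract (e b) F) s.
have -> : \sum_b ext (row b (T^T *m O))^T (contract (delta_mx 0 b) F) s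
    = \sum_a \sum_b X a b.
  rewrite exchange_big /=; apply: eq_bigr => b _.
  have -> : (row b (T^T *m O))^T = \sum_a T a b *: (e a *m O)^T.
    apply/matrixP => i j; rewrite !mxE summxE; apply: eq_bigr => a _.
    by rewrite /e -rowE !mxE.
  by rewrite ext_suml.
have XN : \sum_a \sum_b (T a b)%:C * ext (e b *m O)^T (contract (e a) F) s
    = - \sum_a \sum_b X a b.
  rewrite exchange_big /= -sumrN; apply: eq_bigr => a _.
  rewrite -sumrN; apply: eq_bigr => b _.
  have -> : T b a = - T a b by move/matrixP/(_ a b): sT; rewrite !mxE.
  by rewrite rmorphN mulNr.
have Le : lef O (lam T F) s = 2^-1 * \sum_a \sum_b (T a b)%:C *
    lef O (contract (e b) (contract (e a) F)) s.
  rewrite /lam lefZ; congr (_ * _).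
  transitivity (\sum_a 1 * lef O (fun t => \sum_b (T a b)%:C *
      F [:: e a, e b & t]) s).
    by rewrite -lef_sum; congr lef; apply: funext => t;
      apply: eq_bigr => a _; rewrite mul1r.
  by apply: eq_bigr => a _; rewrite mul1r lef_sum.
rewrite Le.
have -> : \sum_a \sum_b X a b = 2^-1 * (\sum_a \sum_b X a b -
    \sum_a \sum_b (T a b)%:C * ext (e b *m O)^T (contract (e a) F) s).
  by rewrite XN; field.
rewrite -mulrDr -mulrBr /lam; congr (_ * _).
rewrite -!sumrB -!big_split /= -sumrB; apply: eq_bigr => a _.
rewrite -!sumrB -!big_split /= -sumrB; apply: eq_bigr => b _.
rewrite /X /contract /= pairing_delta_l.
have -> : (e a *m O)^T b 0 = O a b by rewrite mxE /e -rowE mxE.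
by rewrite rmorphM; ring.
Qed.

Lemma contract_swap u v F : multilinear F -> alternating F ->
  contract u (contract v F) = fun t => (-1) * contract v (contract u F) t.
Proof.
move=> mF aF; apply: funext => t; rewrite mulN1r.
exact: (alternating_swap [::]).
Qed.

(** This is the number operator [sum_b e^b /\ iota_(e_b)]: through it the identity part of
    [T^T *m O] in [lam_lef] becomes the degree. *)
Lemma ext_contract_degree F s : multilinear F -> alternating F ->
  \sum_b ext (delta_mx b 0) (contract (delta_mx 0 b) F) s = (size s)%:R * F s.
Proof.
elim: s F => [|v s IH] F mF aF /=; first by rewrite mul0r big1.
under eq_bigr => b _ do
  rewrite contract_swap // extZ mulN1r opprK pairing_delta_r.
rewrite big_split /= IH; [|exact: multilinear_contract
  |exact: alternating_contract].
by rewrite -(multilinear_basis [::]) // /contract; ring.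
Qed.

Lemma lamD T F G (x : C) s :
  lam T (fun t => F t + x * G t) s = lam T F s + x * lam T G s.
Proof.
rewrite /lam mulrCA -mulrDr; congr (_ * _).
rewrite mulr_sumr -big_split; apply: eq_bigr => a _ /=.
by rewrite mulr_sumr -big_split; apply: eq_bigr => b _ /=; ring.
Qed.

Lemma lam0 T s : lam T (fun=> 0) s = 0.
Proof.
rewrite /lam big1 ?mulr0 // => a _; rewrite big1 // => b _.
by rewrite mulr0.
Qed.

Lemma lamZ T F (x : C) s : lam T (fun t => x * F t) s = x * lam T F s.
Proof.
have := lamD T (fun=> 0) F x s; rewrite lam0 add0r => <-.
by congr lam; apply: funext => t; rewrite add0r.
Qed.

Lemma lam_sum T I (r : seq I) (x : I -> C) (H : I -> seq V -> C) s :
  lam T (fun t => \sum_(i <- r) x i * H i t) s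
  = \sum_(i <- r) x i * lam T (H i) s.
Proof.
elim: r => [|i r IH].
  rewrite big_nil -[RHS](lam0 T s); congr lam.
  by apply: funext => t; rewrite big_nil.
rewrite big_cons -IH addrC -lamD; congr lam.
by apply: funext => t; rewrite big_cons addrC.
Qed.

Lemma multilinear_lam T F : multilinear F -> multilinear (lam T F).
Proof.
move=> mF s1 u v r s2; rewrite /lam mulrCA -mulrDr; congr (_ * _).
rewrite mulr_sumr -big_split; apply: eq_bigr => a _ /=.
rewrite mulr_sumr -big_split; apply: eq_bigr => b _ /=.
by rewrite -!cat_cons mF; ring.
Qed.

Lemma alternating_lam T F : alternating F -> alternating (lam T F).
Proof.
move=> aF s1 u s2; rewrite /lam big1 ?mulr0 // => a _; rewrite big1 // => b _.
by rewrite -!cat_cons aF mulr0.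
Qed.

Lemma homogeneous_lam k T F : homogeneous k.+2 F -> homogeneous k (lam T F).
Proof.
move=> hF s sk; rewrite /lam big1 ?mulr0 // => a _; rewrite big1 // => b _.
by rewrite hF ?mulr0.
Qed.

Lemma lam_low k T F s : (k < 2)%N -> homogeneous k F -> lam T F s = 0.
Proof.
move=> k2 hF; rewrite /lam big1 ?mulr0 // => a _; rewrite big1 // => b _.
by rewrite hF ?mulr0 //=; case: k k2 {hF} => [|[]].
Qed.

End Sl2.

(** * The commutator of L and Lambda *)

(* O is the matrix of d eta / 2 and T that of the same form with its indices
   raised by the metric. *)
Record contact_algebra (R : rcfType) (d n : nat) (O T : 'M[R]_d)
    (xi : 'rV[R]_d) (eta : 'cV[R]_d) : Prop := {
  ca_dim : d = n.*2.+1;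
  ca_skew : O^T = - O;
  ca_skewT : T^T = - T;
  ca_unit : xi *m eta = 1%:M;
  ca_ker : xi *m O = 0;
  ca_kerT : T *m eta = 0;
  ca_proj : T^T *m O = 1%:M - xi^T *m eta^T }.

Section ContactAlgebra.
Variables (R : rcfType) (d n : nat) (O T : 'M[R]_d).
Variables (xi : 'rV[R]_d) (eta : 'cV[R]_d).
Hypothesis hca : contact_algebra n O T xi eta.
Local Notation V := 'rV[R]_d.
Local Notation C := R[i].
Implicit Types (F : seq V -> C) (s : seq V).
Local Notation L := (lef O).
Local Notation Lam := (lam T).

(* The projection eta /\ iota_xi onto the forms divisible by eta. *)
Definition vert (eta' : 'cV[R]_d) (xi' : V) F s : C :=
  ext eta' (contract xi' F) s.

Local Notation P := (vert eta xi).

(** By [ca_proj] the endomorphism in [lam_lef] is the identity minus a rank-one projection. Half its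
    trace is [(d - 1) / 2 = n]; as a derivation its identity part acts by the degree and its
    rank-one part by [P]. *)
Lemma lam_lef_vert F s : multilinear F -> alternating F ->
  Lam (L F) s = L (Lam F) s + (n%:R - (size s)%:R) * F s + P F s.
Proof.
move=> mF aF; rewrite (lam_lef _ _ _ (ca_skewT hca)).
have -> : 2^-1 * (\sum_a \sum_b (T a b * O a b)%:C * F s) = n%:R * F s.
  transitivity (2^-1 * ((\tr (T^T *m O))%:C * F s)).
    congr (_ * _); rewrite /mxtrace raddf_sum mulr_suml exchange_big /=.
    apply: eq_bigr => b _; rewrite mxE raddf_sum mulr_suml.
    by apply: eq_bigr => a _; rewrite mxE.
  have -> : \tr (T^T *m O) = n.*2%:R.
    rewrite (ca_proj hca) linearB /= mxtrace1 mxtrace_mulC -trmx_mul.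
    by rewrite (ca_unit hca) trmx1 mxtrace1 {1}(ca_dim hca) -natrB // subn1.
  by rewrite -muln2 natrM rmorphM !rmorph_nat; field.
have -> : \sum_b ext (row b (T^T *m O))^T (contract (delta_mx 0 b) F) s
    = (size s)%:R * F s - P F s.
  rewrite -(ext_contract_degree s mF aF) /vert.
  have -> : contract xi F
      = fun t => \sum_b (xi 0 b)%:C * contract (delta_mx 0 b) F t.
    by apply: funext => t; exact: (multilinear_basis [::]).
  rewrite ext_sum -sumrB; apply: eq_bigr => b _.
  have -> : (row b (T^T *m O))^T = delta_mx b 0 + (- xi 0 b) *: eta.
    rewrite (ca_proj hca); apply/matrixP => i j.
    rewrite !mxE big_ord1 !mxE !ord1 eqxx andbT eq_sym mulNr; congr (_%:R - _).
  by rewrite extDl rmorphN mulNr.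
by rewrite mulrBl; ring.
Qed.

Lemma vertD F G (x : C) s : P (fun t => F t + x * G t) s = P F s + x * P G s.
Proof. by rewrite /vert -extD. Qed.

(** [iota_xi O = 0], and the 1-form [eta] commutes with the 2-form [O]. *)
Lemma vert_lef F s : P (L F) s = L (P F) s.
Proof.
rewrite /vert -ext_lef; congr ext; apply: funext => t.
by rewrite /contract /= (ca_ker hca) trmx0 ext0l addr0.
Qed.

(** [Lam] commutes with [iota_xi] because [xi] moves past two entries, and with [eta /\ _] because
    every term in which [T] meets [eta] vanishes by [ca_kerT]. *)
Lemma vert_lam F s : multilinear F -> alternating F ->
  Lam (P F) s = P (Lam F) s.
Proof.
move=> mF aF; rewrite /vert.
have -> : contract xi (Lam F) = Lam (contract xi F).
  apply: funext => t; rewrite /contract /lam; congr (_ * _).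
  apply: eq_bigr => a _; apply: eq_bigr => b _; congr (_ * _).
  rewrite (alternating_swap [:: _]) //= (alternating_swap [::]) //=.
  by rewrite opprK.
set G := contract xi F.
have kT a : \sum_b T a b * eta b 0 = 0.
  by have /matrixP/(_ a 0) := ca_kerT hca; rewrite !mxE.
have kT' b : \sum_a T a b * eta a 0 = 0.
  apply/eqP; rewrite -oppr_eq0 -sumrN -[X in _ == X](kT b); apply/eqP.
  apply: eq_bigr => a _; rewrite -mulNr; congr (_ * _).
  by move/matrixP/(_ a b): (ca_skewT hca); rewrite !mxE => ->.
have E a b : (T a b)%:C * ext eta G [:: delta_mx 0 a, delta_mx 0 b & s]
    = (T a b * eta a 0)%:C * G (delta_mx 0 b :: s)
    - (T a b * eta b 0)%:C * G (delta_mx 0 a :: s)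
    + (T a b)%:C * ext eta (fun t => G [:: delta_mx 0 a, delta_mx 0 b & t]) s.
  by rewrite /= !pairing_delta_l /contract !rmorphM; ring.
rewrite {1}/lam; under eq_bigr => a _ do under eq_bigr => b _ do rewrite E.
under eq_bigr => a _.
  rewrite big_split /= sumrB -[X in _ - X]mulr_suml -raddf_sum kT mul0r subr0.
  over.
rewrite big_split /= exchange_big /= big1 ?add0r => [|b _]; last first.
  by rewrite -mulr_suml -raddf_sum kT' mul0r.
rewrite /lam extZ; congr (_ * _).
transitivity (\sum_a 1 * ext eta (fun t => \sum_b (T a b)%:C *
      G [:: delta_mx 0 a, delta_mx 0 b & t]) s).
  by apply: eq_bigr => a _; rewrite mul1r ext_sum.
by rewrite -ext_sum; congr ext; apply: funext => t;
  apply: eq_bigr => a _; rewrite mul1r.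
Qed.

(** [iota_xi (eta /\ G) = G - eta /\ iota_xi G] since [eta(xi) = 1], and [eta /\ eta = 0]. *)
Lemma vert_idem F s : alternating F -> P (P F) s = P F s.
Proof.
move=> aF; rewrite /vert.
have -> : contract xi (ext eta (contract xi F)) = fun t =>
    contract xi F t - ext eta (contract xi (contract xi F)) t.
  apply: funext => t; rewrite {1}/contract /=.
  by rewrite /pairing (ca_unit hca) mxE /= mul1r.
rewrite extB ext_ext0 subr0 //.
Qed.

Lemma multilinear_vert F : multilinear F -> multilinear (P F).
Proof. by move=> mF; exact/multilinear_ext/multilinear_contract. Qed.

Lemma alternating_vert F : alternating F -> alternating (P F).
Proof. by move=> aF; exact/alternating_ext/alternating_contract. Qed.

Lemma homogeneous_vert k F : homogeneous k F -> homogeneous k (P F).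
Proof.
case: k => [|k] hF; last exact/homogeneous_ext/homogeneous_contract.
by rewrite /vert contract_homogeneous0 // => s _; rewrite ext0.
Qed.

Record kform k F : Prop := {
  kf_mul : multilinear F;
  kf_alt : alternating F;
  kf_hom : homogeneous k F }.

Lemma kform_lef k F : kform k F -> kform k.+2 (L F).
Proof.
case=> mF aF hF; split; [exact: multilinear_lef| |exact: homogeneous_lef].
exact/(alternating_lef (ca_skew hca)).
Qed.

Lemma kform_iter_lef k j F : kform k F -> kform (j.*2 + k)%N (iter j L F).
Proof. by move=> kF; elim: j => //= j IH; exact: kform_lef. Qed.

Lemma vert_iter_lef e j F : P F = (fun t => e * F t) ->
  P (iter j L F) = fun t => e * iter j L F t.
Proof.
move=> PF; elim: j => //= j IH; apply: funext => t.
by rewrite vert_lef IH lefZ.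
Qed.

Lemma lam_lef_weight k e F : kform k F -> P F = (fun t => e * F t) ->
  Lam (L F) = fun s => L (Lam F) s + (n%:R - k%:R + e) * F s.
Proof.
case=> mF aF hF PF; apply: funext => s; rewrite lam_lef_vert // PF.
have [->|sk] := eqVneq (size s) k; first by ring.
by rewrite hF //; ring.
Qed.

(** The weights [n - k - 2i + e] of the [L^i F] with [i <= j] add up to [(j + 1)(n - k + e - j)]. *)
Lemma lam_iter_lef k e j F : kform k F -> P F = (fun t => e * F t) ->
  Lam (iter j.+1 L F) = fun s => iter j.+1 L (Lam F) s
    + j.+1%:R * (n%:R - k%:R + e - j%:R) * iter j L F s.
Proof.
move=> kF PF; elim: j => [|j IH].
  by rewrite (lam_lef_weight kF PF); apply: funext => s /=; ring.
rewrite iterS (lam_lef_weight (kform_iter_lef j.+1 kF) (vert_iter_lef _ PF)).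
rewrite IH; apply: funext => s; rewrite lefD -!iterS natrD.
by rewrite -!muln2 !natrM -!natr1; ring.
Qed.

Lemma iter_lef0 j : iter j L (fun=> 0) = fun=> 0.
Proof.
by elim: j => //= j ->; apply: funext => s; rewrite lef0.
Qed.

(* A vector of negative weight killed by L Lam vanishes: its L-tower never
   stops, while L is nilpotent. *)
Lemma negative_weight_eq0 k (e : C) r F :
  kform k F -> P F = (fun t => e * F t) ->
  L (Lam F) = (fun=> 0) -> n%:R - k%:R + e = - r.+1%:R -> F = fun=> 0.
Proof.
move=> kF PF LF we.
have : iter d.+1 L F = fun=> 0.
  apply: funext => s; have [mG aG hG] := kform_iter_lef d.+1 kF.
  apply: (homogeneous_ge_dim s mG aG hG).
  by apply: leq_trans (leq_addr _ _); rewrite -addnn leq_addr.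
(* Downward along the tower: if [L^(j+1) F = 0], the commutation formula reduces, up to sign, to
   [(j + 1)(r + 1 + j) L^j F = 0], and the coefficient is positive. *)
elim: d.+1 => // j IH Lj; apply: IH; apply: funext => s.
have := congr1 (fun f => f s) (lam_iter_lef j kF PF).
rewrite Lj lam0 iterSr LF iter_lef0 add0r we => /esym/eqP.
rewrite mulf_eq0 => /orP[|/eqP //].
by rewrite -opprD -natrD mulrN oppr_eq0 -natrM pnatr_eq0.
Qed.

(* The case in which Lambda F = L^h q has no solution in the tower of q. *)
Lemma lam_preimage_top k0 h (e : C) q F :
  kform k0 q -> P q = (fun t => e * q t) -> Lam q = (fun=> 0) ->
  n%:R - k0%:R + e = h%:R ->
  kform (h.*2 + k0)%N.+2 F -> P F = (fun t => e * F t) -> Lam F = iter h L q ->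
  F = fun=> 0.
Proof.
move=> kq Pq Lq wq kF PF LF.
(* The factor [n - k0 + e - h] of [lam_iter_lef] is 0, so [Lam] kills [L^(h+1) q], whose weight
   [h - 2(h + 1) = -(h + 2)] is negative. *)
have Lhq : iter h.+1 L q = fun=> 0.
  apply: (negative_weight_eq0 (r := h.+1) (kform_iter_lef h.+1 kq)
    (vert_iter_lef _ Pq)).
    rewrite (lam_iter_lef _ kq Pq) Lq iter_lef0 wq subrr mulr0.
    by apply: funext => s; rewrite -[RHS](lef0 O s); congr lef;
      apply: funext => t; rewrite mul0r addr0.
  have -> : e = h%:R - n%:R + k0%:R by rewrite -wq; ring.
  by rewrite natrD -muln2 natrM -!natr1; ring.
(* [F] has the degree of [L^(h+1) q], hence its weight, and [L Lam F = L^(h+1) q = 0]. *)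
apply: (negative_weight_eq0 (r := h.+1) kF PF).
  by rewrite LF -iterS Lhq.
have -> : e = h%:R - n%:R + k0%:R by rewrite -wq; ring.
by rewrite -!natr1 natrD -muln2 natrM; ring.
Qed.

End ContactAlgebra.

(** * The Hermitian product *)

Section InnerProduct.
Variables (R : rcfType) (d : nat).
Local Notation V := 'rV[R]_d.
Local Notation C := R[i].
Implicit Types (F H : seq V -> C) (s : seq V) (c : 'cV[R]_d) (N : 'M[R]_d).

(* N is the inverse of the Gram matrix; the factors 1/k make up the 1/k! of
   form_dot. *)
Fixpoint form_ip N k F H : C :=
  if k is k'.+1 then
    k%:R^-1 * \sum_a \sum_b (N a b)%:C *
      form_ip N k' (contract (delta_mx 0 a) F) (contract (delta_mx 0 b) H)
  else F [::] * (H [::])^*.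

Lemma ipDl N k F F' (x : C) H :
  form_ip N k (fun t => F t + x * F' t) H
  = form_ip N k F H + x * form_ip N k F' H.
Proof.
elim: k F F' H => [|k IH] F F' H /=; first by ring.
rewrite mulrCA -mulrDr; congr (_ * _).
rewrite mulr_sumr -big_split; apply: eq_bigr => a _ /=.
rewrite mulr_sumr -big_split; apply: eq_bigr => b _ /=.
by rewrite (IH (contract _ F) (contract _ F')); ring.
Qed.

Lemma ipDr N k F H H' (x : R) :
  form_ip N k F (fun t => H t + x%:C * H' t)
  = form_ip N k F H + x%:C * form_ip N k F H'.
Proof.
elim: k F H H' => [|k IH] F H H' /=.
  rewrite rmorphD rmorphM /= -[(x%:C)^*]/((x%:C)^*)%C conjc_real.
  by ring.
rewrite mulrCA -mulrDr; congr (_ * _).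
rewrite mulr_sumr -big_split; apply: eq_bigr => a _ /=.
rewrite mulr_sumr -big_split; apply: eq_bigr => b _ /=.
by rewrite (IH _ (contract _ H) (contract _ H')); ring.
Qed.

Lemma ip0l N k H : form_ip N k (fun=> 0) H = 0.
Proof.
elim: k H => [|k IH] H /=; first by rewrite mul0r.
rewrite big1 ?mulr0 // => a _; rewrite big1 // => b _.
by rewrite [form_ip _ _ _ _]IH mulr0.
Qed.

Lemma ip0r N k F : form_ip N k F (fun=> 0) = 0.
Proof.
elim: k F => [|k IH] F /=; first by rewrite conjC0 mulr0.
rewrite big1 ?mulr0 // => a _; rewrite big1 // => b _.
by rewrite [form_ip _ _ _ _]IH mulr0.
Qed.

Lemma ip_suml N k I (r : seq I) (x : I -> C) (F : I -> seq V -> C) H :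
  form_ip N k (fun t => \sum_(i <- r) x i * F i t) H
  = \sum_(i <- r) x i * form_ip N k (F i) H.
Proof.
elim: r => [|i r IH].
  rewrite big_nil -[RHS](ip0l N k H); congr form_ip.
  by apply: funext => t; rewrite big_nil.
rewrite big_cons -IH addrC -ipDl; congr form_ip.
by apply: funext => t; rewrite big_cons addrC.
Qed.

Lemma ip_sumr N k I (r : seq I) (x : I -> R) F (H : I -> seq V -> C) :
  form_ip N k F (fun t => \sum_(i <- r) (x i)%:C * H i t)
  = \sum_(i <- r) (x i)%:C * form_ip N k F (H i).
Proof.
elim: r => [|i r IH].
  rewrite big_nil -[RHS](ip0r N k F); congr form_ip.
  by apply: funext => t; rewrite big_nil.
rewrite big_cons -IH addrC -ipDr; congr form_ip.
by apply: funext => t; rewrite big_cons addrC.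
Qed.

Lemma contract_sum H (v : V) : multilinear H ->
  contract v H = fun t => \sum_b (v 0 b)%:C * contract (delta_mx 0 b) H t.
Proof. by move=> mH; apply: funext => t; exact: (multilinear_basis [::]). Qed.

(** Exterior product with [c] is adjoint to contraction with its metric dual. In degree [k + 2] the
    Leibniz rule for [iota_(e_a) (c /\ F)] gives the right-hand side once ([E1]) and, by induction,
    [k + 1] further times ([E2]); this cancels the factor [1 / (k + 2)] of [form_ip]. *)
Lemma ip_ext N k c F H : multilinear H -> alternating H ->
  form_ip N k.+1 (ext c F) H = form_ip N k F (contract (c^T *m N) H).
Proof.
elim: k F H => [|k IH] F H mH aH.
  rewrite contract_sum // ip_sumr /= invr1 mul1r exchange_big /=.
  apply: eq_bigr => b _; rewrite mxE raddf_sum mulr_suml; apply: eq_bigr => a _.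
  by rewrite {1}/contract /= pairing_delta_l subr0 mxE rmorphM; ring.
have step a b : form_ip N k.+1 (contract (delta_mx 0 a) (ext c F))
      (contract (delta_mx 0 b) H)
    = (c a 0)%:C * form_ip N k.+1 F (contract (delta_mx 0 b) H)
    + form_ip N k (contract (delta_mx 0 a) F)
        (contract (delta_mx 0 b) (contract (c^T *m N) H)).
  have -> : contract (delta_mx 0 a) (ext c F) = fun t =>
      (c a 0)%:C * F t + (-1) * ext c (contract (delta_mx 0 a) F) t.
    by apply: funext => t; rewrite {1}/contract /= pairing_delta_l mulN1r.
  have -> : (fun t => (c a 0)%:C * F t
        + (-1) * ext c (contract (delta_mx 0 a) F) t)
      = (fun t => (0 + (c a 0)%:C * F t)
        + (-1) * ext c (contract (delta_mx 0 a) F) t).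
    by apply: funext => t; rewrite add0r.
  rewrite ipDl (ipDl _ _ (fun=> 0)) ip0l add0r IH; last 2 first.
  - exact: multilinear_contract.
  - exact: alternating_contract.
  rewrite (contract_swap _ _ mH aH).
  have -> : (fun t => -1 * contract (delta_mx 0 b) (contract (c^T *m N) H) t)
    = (fun t => 0 + (-1)%:C *
        contract (delta_mx 0 b) (contract (c^T *m N) H) t).
    by apply: funext => t; rewrite add0r rmorphN rmorph1.
  by rewrite ipDr ip0r rmorphN rmorph1; ring.
have E1 : \sum_a \sum_b (N a b)%:C *
      ((c a 0)%:C * form_ip N k.+1 F (contract (delta_mx 0 b) H))
    = form_ip N k.+1 F (contract (c^T *m N) H).
  rewrite [in RHS]contract_sum // ip_sumr exchange_big /=.
  apply: eq_bigr => b _; rewrite [in RHS]mxE rmorph_sum [in RHS]mulr_suml.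
  apply: eq_bigr => a _.
  rewrite [in RHS]mxE. rewrite rmorphM; ring.
have E2 : \sum_a \sum_b (N a b)%:C * form_ip N k (contract (delta_mx 0 a) F)
        (contract (delta_mx 0 b) (contract (c^T *m N) H))
    = k.+1%:R * form_ip N k.+1 F (contract (c^T *m N) H).
  by rewrite /= mulVKf ?pnatr_eq0.
transitivity (k.+2%:R^-1 * (form_ip N k.+1 F (contract (c^T *m N) H)
   + k.+1%:R * form_ip N k.+1 F (contract (c^T *m N) H))).
  rewrite -E2 -{1}E1 -big_split.
  change (k.+2%:R^-1 * \sum_a \sum_b (N a b)%:C *
    form_ip N k.+1 (contract (delta_mx 0 a) (ext c F))
      (contract (delta_mx 0 b) H)
    = k.+2%:R^-1 * \sum_a
    (\sum_b (N a b)%:C *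
       ((c a 0)%:C * form_ip N k.+1 F (contract (delta_mx 0 b) H))
     + \sum_b (N a b)%:C *
      form_ip N k (contract (delta_mx 0 a) F)
        (contract (delta_mx 0 b) (contract (c^T *m N) H)))).
  congr (_ * _); apply: eq_bigr => a _; rewrite -big_split.
  by apply: eq_bigr => b _; rewrite step mulrDr.
by rewrite -[X in X + _]mul1r -mulrDl nat1r mulKf // pnatr_eq0.
Qed.

(** By [lefE] the 2-form is a sum of products of two 1-forms, and [ip_ext] moves each factor across
    as a contraction with its metric dual; the contracted pairs assemble to the bivector
    [N *m O *m N]. *)
Lemma ip_lef N O k F H : N^T = N -> O^T = - O -> multilinear F ->
  multilinear H -> alternating H ->
  form_ip N k.+2 (lef O F) H = form_ip N k F (lam (N *m O *m N) H).
Proof.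
move=> sN sO mF mH aH.
have -> : lef O F = fun t => \sum_b 2^-1 *
    ext (delta_mx b 0) (ext (delta_mx 0 b *m O)^T F) t.
  apply: funext => t; rewrite -mulr_sumr -(lefE _ sO mF) mulKf //.
  by rewrite pnatr_eq0.
rewrite ip_suml.
under eq_bigr => b _.
  rewrite ip_ext // ip_ext; last 2 first.
  - exact: multilinear_contract.
  - exact: alternating_contract.
  rewrite trmxK trmx_delta; over.
have -> : lam (N *m O *m N) H = fun t => \sum_b (2^-1)%:C *
    contract (delta_mx 0 b *m O *m N) (contract (delta_mx 0 b *m N) H) t.
  apply: funext => t; rewrite /lam -mulr_sumr fmorphV rmorph_nat.
  congr (_ * _).
  transitivity (\sum_b \sum_a \sum_l ((N b a)%:C * ((O *m N) b l)%:C) *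
      H [:: delta_mx 0 a, delta_mx 0 l & t]); last first.
    apply: eq_bigr => b _.
    apply: etrans (esym (multilinear_basis [::] _ (_ :: t) mH)).
    apply: eq_bigr => a _.
    rewrite (multilinear_basis [:: delta_mx 0 a]) // mulr_sumr.
    apply: eq_bigr => l _ /=.
    by rewrite -mulmxA -!rowE !mxE mulrA.
  rewrite [RHS]exchange_big /=; apply: eq_bigr => a _.
  rewrite [RHS]exchange_big /=; apply: eq_bigr => l _.
  rewrite -mulmxA mxE rmorph_sum mulr_suml; apply: eq_bigr => b _.
  have -> : N b a = N a b by rewrite -[in LHS]sN mxE.
  by rewrite rmorphM.
by rewrite ip_sumr; apply: eq_bigr => b _; rewrite fmorphV rmorph_nat.
Qed.

(** Testing [H] against [c /\ F], with [c] metrically dual to [v], pairs [F] with [contract v H]; so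
    induction on the degree applies to every contraction of [H]. *)
Lemma ip_nondegenerate N k H : N^T = N -> N \in unitmx -> kform k H ->
  (forall F, kform k F -> form_ip N k F H = 0) -> H = fun=> 0.
Proof.
move=> sN uN; elim: k H => [|k IH] H [mH aH hH] H0.
  apply: funext => -[|v s]; last exact: hH.
  have : form_ip N 0 (fun s => (size s == 0)%:R) H = 0.
    apply: H0; split=> [s1 u v r s2|s1 u s2|s /negPf ->] //;
      by rewrite !size_cat /= !addnS // mulr0 addr0.
  by rewrite /= mul1r => /eqP; rewrite conjC_eq0 => /eqP.
apply: funext => -[|v s]; first exact: hH.
suff : contract v H = fun=> 0 by move/(congr1 (fun f => f s)).
apply: IH; first by split; [exact: multilinear_contract
  |exact: alternating_contract|exact: homogeneous_contract].
move=> F [mF aF hF].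
have := H0 (ext (invmx N *m v^T) F); rewrite ip_ext //.
rewrite trmx_mul trmxK trmx_inv sN mulmxKV // => -> //.
by split; [exact: multilinear_ext|exact: alternating_ext
  |exact: homogeneous_ext].
Qed.

End InnerProduct.

(** * Lists and matrices of vectors *)

Section MatrixForms.
Variables (R : realType) (d : nat).
Local Notation V := 'rV[R]_d.
Local Notation C := R[i].
Implicit Types (F : seq V -> C) (s : seq V).

Definition rows k (A : 'M[R]_(k, d)) : seq V := [seq row i A | i <- enum 'I_k].

Definition list_form k (f : 'M[R]_(k, d) -> C) s : C :=
  if size s == k then f (\matrix_(i < k) s`_i) else 0.

Lemma size_rows k (A : 'M[R]_(k, d)) : size (rows A) = k.
Proof. by rewrite size_map size_enum_ord. Qed.

Lemma nth_rows k (A : 'M[R]_(k, d)) (i : 'I_k) : (rows A)`_i = row i A.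
Proof. by rewrite (nth_map i) ?size_enum_ord // nth_ord_enum. Qed.

Lemma rowsK k (A : 'M[R]_(k, d)) : \matrix_(i < k) (rows A)`_i = A.
Proof. by apply/row_matrixP => i; rewrite rowK nth_rows. Qed.

Lemma rows_mx k s : size s = k -> rows (\matrix_(i < k) s`_i) = s.
Proof.
move=> sk; apply: (@eq_from_nth _ 0); rewrite size_rows // => i ik.
by rewrite (nth_rows _ (Ordinal ik)) rowK.
Qed.

Lemma list_form_rows k (f : 'M[R]_(k, d) -> C) A : list_form f (rows A) = f A.
Proof. by rewrite /list_form size_rows eqxx rowsK. Qed.

Lemma list_formK k F : homogeneous k F ->
  list_form (fun A : 'M[R]_(k, d) => F (rows A)) = F.
Proof.
move=> hF; apply: funext => s; rewrite /list_form.
by case: eqP => [sk|/eqP sk]; rewrite ?rows_mx // hF.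
Qed.

Lemma homogeneous_list_form k (f : 'M[R]_(k, d) -> C) :
  homogeneous k (list_form f).
Proof. by move=> s /negPf sk; rewrite /list_form sk. Qed.

Lemma rows_split k (A : 'M[R]_(k, d)) (i : 'I_k) :
  rows A = take i (rows A) ++ row i A :: drop i.+1 (rows A).
Proof.
by rewrite -nth_rows -drop_nth ?size_rows // cat_take_drop.
Qed.

Lemma rows_row' k (A : 'M[R]_(k.+1, d)) (i : 'I_k.+1) :
  rows (row' i A) = take i (rows A) ++ drop i.+1 (rows A).
Proof.
have si : (size (take i (rows A)) = i)%N.
  by rewrite size_takel // size_rows ltnW.
apply: (@eq_from_nth _ 0) => [|j].
  by rewrite size_cat si size_drop !size_rows subSS subnKC // -ltnS.
rewrite size_rows => jk; rewrite (nth_rows _ (Ordinal jk)) nth_cat si.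
have -> : row (Ordinal jk) (row' i A) = (rows A)`_(bump i j).
  by rewrite (nth_rows A (lift i (Ordinal jk))) ; apply/rowP => l; rewrite !mxE.
rewrite /bump; case: ltnP => ij; first by rewrite nth_take.
by rewrite nth_drop addSn subnKC.
Qed.

Lemma rows_cat_row' k (A : 'M[R]_(k, d)) (i : 'I_k) B :
  row' i B = row' i A ->
  rows B = take i (rows A) ++ row i B :: drop i.+1 (rows A).
Proof.
case: k A i B => [? []//|k] A i B /(congr1 (@rows _)).
rewrite !rows_row' => BA.
have sz (D : 'M[R]_(k.+1, d)) : size (take i (rows D)) = i.
  by rewrite size_takel // size_rows ltnW.
move: BA => /eqP; rewrite eqseq_cat ?sz // => /andP[/eqP <- /eqP <-].
exact: rows_split.
Qed.

Lemma altform_rows k F : multilinear F -> alternating F ->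
  altform (fun A : 'M[R]_(k, d) => F (rows A)).
Proof.
move=> mF aF; split=> [A B D i b c rA BA DA|A i1 i2].
  rewrite {1}(rows_split A i) rA (rows_cat_row' BA) (rows_cat_row' DA).
  by rewrite mF multilinear_scale.
wlog lt12 : i1 i2 / (i1 < i2)%N.
  move=> th i12 r12; case: (ltngtP i1 i2) => [lt12|lt21|e12].
  - exact: (th i1 i2).
  - by apply: (th i2 i1); rewrite // eq_sym.
  - by rewrite (val_inj e12) eqxx in i12.
move=> _ r12.
rewrite (rows_split A i1).
have -> : drop i1.+1 (rows A)
    = take (i2 - i1.+1) (drop i1.+1 (rows A))
      ++ row i2 A :: drop i2.+1 (rows A).
  rewrite -nth_rows -[in LHS](cat_take_drop (i2 - i1.+1) (drop i1.+1 (rows A))).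
  by rewrite drop_drop subnK // -drop_nth ?size_rows.
by rewrite r12 alternating_repeat.
Qed.

Lemma nth_cat_cons_ne s1 (u v : V) s2 m : m != size s1 ->
  (s1 ++ v :: s2)`_m = (s1 ++ u :: s2)`_m.
Proof.
rewrite !nth_cat neq_ltn; case: ltnP => //= s1m s1m'.
by case: (m - size s1)%N (subn_gt0 (size s1) m) s1m' => [<-|].
Qed.

Lemma kform_list_form k (f : 'M[R]_(k, d) -> C) :
  altform f -> kform k (list_form f).
Proof.
move=> [lf af]; split; last exact: homogeneous_list_form.
- move=> s1 u v r s2; rewrite /list_form !size_cat /= !addnS.
  case: eqP => [sk|]; last by rewrite mulr0 addr0.
  have s1k : (size s1 < k)%N by rewrite -sk ltnS leq_addr.
  pose i0 := Ordinal s1k.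
  have ne (j : 'I_k.-1) : (lift i0 j : nat) != size s1.
    by rewrite eq_sym; exact: (neq_lift i0 j).
  rewrite (lf _ (\matrix_(i < k) (s1 ++ u :: s2)`_i)
    (\matrix_(i < k) (s1 ++ v :: s2)`_i) i0 1 r) ?rmorph1 ?mul1r //.
  + by rewrite !rowK /= !nth_cat ltnn subnn /= scale1r.
  + apply/matrixP => j l.
    by rewrite !mxE (nth_cat_cons_ne (u + r *: v) _ _ (ne j)).
  + apply/matrixP => j l.
    by rewrite !mxE (nth_cat_cons_ne (u + r *: v) _ _ (ne j)).
- move=> s1 u s2; rewrite /list_form.
  case: eqP => [sk|//].
  have s2k : ((size s1).+1 < k)%N.
    by rewrite -sk size_cat /= !addnS !ltnS leq_addr.
  apply: (af _ (Ordinal (ltnW s2k)) (Ordinal s2k)).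
    by rewrite -val_eqE /= neq_ltn leqnn.
  by rewrite !rowK /= !nth_cat ltnn subnn /= ltnNge leqnSn /= subSnn.
Qed.

End MatrixForms.

(** * The wedge product, the Hermitian product and Lambda in terms of lists *)

Section Wedge.
Variables (R : realType) (d : nat).
Local Notation V := 'rV[R]_d.
Local Notation C := R[i].
Implicit Types (F G : seq V -> C) (s : seq V) (O N : 'M[R]_d).

Lemma sum_lift_perm k (H : 'S_k.+1 -> C) :
  \sum_s H s = \sum_(j < k.+1) \sum_(s : 'S_k) H (lift_perm ord0 j s).
Proof.
pose f (p : 'I_k.+1 * 'S_k) := lift_perm ord0 p.1 p.2.
rewrite pair_bigA /= (reindex f) //; apply: onW_bij.
apply: inj_card_bij; last by rewrite card_prod card_ord !card_Sn.
move=> [i s] [j t] /= fst_eq.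
have ij : i = j.
  have := congr1 (fun p : 'S_k.+1 => p ord0) fst_eq.
  by rewrite /f !lift_perm_id.
rewrite ij in fst_eq *; congr (_, _); apply/permP => l.
have := congr1 (fun p : 'S_k.+1 => p (lift ord0 l)) fst_eq.
by rewrite /f /= !lift_perm_lift => /lift_inj.
Qed.

Definition altsum k G (A : 'M[R]_(k, d)) : C :=
  \sum_(s : 'S_k) (-1) ^+ s * G (rows (row_perm s A)).

Lemma rowsS k (A : 'M[R]_(k.+1, d)) :
  rows A = row ord0 A :: rows (row' ord0 A).
Proof. by rewrite {1}(rows_split A ord0) rows_row' /= take0. Qed.

(** Permutations are grouped by the row they bring to the front, as in a Laplace expansion;
    [lift_perm] contributes the sign [(-1)^j]. *)
Lemma altsumS k G (A : 'M[R]_(k.+1, d)) :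
  altsum G A
  = \sum_(j < k.+1) (-1) ^+ j * altsum (contract (row j A) G) (row' j A).
Proof.
rewrite /altsum sum_lift_perm; apply: eq_bigr => j _.
rewrite mulr_sumr; apply: eq_bigr => s _.
rewrite odd_lift_perm /= signr_addb signr_odd mulrA; congr (_ * _).
rewrite rowsS /contract; congr (G (_ :: _)); last congr rows.
  by apply/rowP => l; rewrite !mxE lift_perm_id.
by apply/matrixP => i l; rewrite !mxE lift_perm_lift.
Qed.

Lemma alternating_to_front F s1 u s2 : multilinear F -> alternating F ->
  F (u :: s1 ++ s2) = (-1) ^+ size s1 * F (s1 ++ u :: s2).
Proof.
move=> mF aF; elim: s1 F mF aF => [|v s1 IH] F mF aF /=; first by rewrite mul1r.
rewrite (alternating_swap [::]) //= exprS -mulrA mulN1r; congr (- _).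
apply: (IH (contract v F)); [exact: multilinear_contract
  |exact: alternating_contract].
Qed.

Lemma altsum_alternating k F (A : 'M[R]_(k, d)) :
  multilinear F -> alternating F -> altsum F A = k`!%:R * F (rows A).
Proof.
elim: k F A => [|k IH] F A mF aF.
  rewrite /altsum (eq_bigr (fun=> F (rows A))) => [|s _].
    by rewrite sumr_const card_Sn mulr_natl.
  have -> : s = 1%g by apply/permP => -[].
  by rewrite odd_perm1 mul1r row_perm1.
rewrite altsumS (eq_bigr (fun=> k`!%:R * F (rows A))) => [|j _].
  by rewrite sumr_const card_ord factS natrM -mulrA [RHS]mulr_natl.
rewrite IH; [|exact: multilinear_contract|exact: alternating_contract].
rewrite rows_row' /contract alternating_to_front //.
rewrite size_takel ?size_rows 1?ltnW // -rows_split.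
rewrite mulrCA; congr (_ * _).
by rewrite mulrA -signr_odd -expr2 sqrr_sign mul1r.
Qed.

Lemma ext_rows k c F (A : 'M[R]_(k.+1, d)) :
  ext c F (rows A)
  = \sum_(j < k.+1) (-1) ^+ j * (pairing (row j A) c * F (rows (row' j A))).
Proof.
elim: k F A => [|k IH] F A.
  by rewrite rowsS big_ord1 mul1r /= [rows _](size0nil (size_rows _)) subr0.
rewrite rowsS big_ord_recl mul1r; rewrite [LHS]/=; congr (_ + _).
rewrite IH -sumrN; apply: eq_bigr => j _.
rewrite exprS mulN1r mulNr; congr (- (_ * (pairing _ _ * F _))).
  by apply/rowP => l; rewrite !mxE.
rewrite [RHS]rowsS; congr (_ :: _); last congr rows.
  by apply/rowP => l; rewrite !mxE; congr (A _ _); apply: val_inj.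
by apply/matrixP => i l; rewrite !mxE; congr (A _ _); apply: val_inj;
  rewrite /= /bump /= !add1n ltnS addnS.
Qed.

Lemma lef_rows k O F (A : 'M[R]_(k.+2, d)) : O^T = - O -> multilinear F ->
  2 * lef O F (rows A) = \sum_(j < k.+2) (-1) ^+ j *
    \sum_(l < k.+1) (-1) ^+ l *
      (((row j A *m O *m (row l (row' j A))^T) 0 0)%:C
       * F (rows (row' l (row' j A)))).
Proof.
move=> sO mF; rewrite lefE //.
under eq_bigr => b _ do rewrite ext_rows.
rewrite exchange_big /=; apply: eq_bigr => j _.
rewrite -mulr_sumr; congr (_ * _).
transitivity (ext (row j A *m O)^T F (rows (row' j A))).
  have -> : (row j A *m O)^T = \sum_b (row j A) 0 b *: (delta_mx 0 b *m O)^T.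
    rewrite {1}[row j A]row_sum_delta mulmx_suml linear_sum /=.
    by apply: eq_bigr => b _; rewrite -scalemxAl linearZ.
  by rewrite ext_suml; apply: eq_bigr => b _; rewrite pairing_delta_r.
rewrite ext_rows; apply: eq_bigr => l _; congr (_ * (_ * _)).
rewrite /pairing; congr (_%:C).
by rewrite -[in RHS](trmxK (row j A *m O)) -trmx_mul [RHS]mxE.
Qed.

(** [wedge] antisymmetrises the tensor product [G]. Expanding along two rows leaves the
    antisymmetrisation of [a], which is [k!] copies of [a], under the double sum of [lef_rows],
    which is [2 * lef]; so the factor [2! k!] by which [wedge] divides cancels. *)
Lemma wedge_lef k O (a2 : 'M[R]_(2, d) -> C) (a : 'M[R]_(k, d) -> C) A :
  O^T = - O ->
  (forall B, a2 B = ((row ord0 B *m O *m (row ord_max B)^T) 0 0)%:C) ->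
  altform a -> wedge a2 a A = lef O (list_form a) (rows A).
Proof.
move=> sO a2E /kform_list_form[mF aF _].
pose G s := if s is u :: v :: t then
  ((u *m O *m v^T) 0 0)%:C * list_form a t else 0.
have -> : wedge a2 a A = (2`! * k`!)%:R^-1 * altsum G A.
  rewrite /wedge /altsum; congr (_ * _); apply: eq_bigr => s _.
  rewrite -mulrA; congr (_ * _); move: (row_perm s A) => B.
  rewrite (rowsS (B : 'M_(k.+2, d))) rowsS /=.
  congr (_ * _).
    rewrite a2E; congr (_%:C); congr ((_ *m _ *m _^T) 0 0);
    by apply/rowP => l; rewrite !mxE; congr (B _ _); apply: val_inj.
  rewrite -[a _]list_form_rows; congr (list_form a _); congr rows.
  by apply/matrixP => i l; rewrite !mxE; congr (B _ _); apply: val_inj.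
have -> : altsum G (A : 'M_(k.+2, d))
    = k`!%:R * (2 * lef O (list_form a) (rows A)).
  rewrite (lef_rows (A : 'M_(k.+2, d)) sO mF) altsumS mulr_sumr.
  apply: eq_bigr => j _; rewrite mulrCA; congr (_ * _).
  rewrite altsumS mulr_sumr; apply: eq_bigr => l _.
  rewrite mulrCA; congr (_ * _).
  rewrite /altsum; under eq_bigr => s _ do rewrite /contract /= mulrCA.
  by rewrite -mulr_sumr -/(altsum _ _) altsum_alternating // mulrCA.
have nzf j : j`!%:R != 0 :> C by rewrite pnatr_eq0 -lt0n fact_gt0.
by rewrite natrM invfM -mulrA mulKf // mulKf // pnatr_eq0.
Qed.

Definition fcons (T : Type) k (a : T) (I : {ffun 'I_k -> T}) :
    {ffun 'I_k.+1 -> T} :=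
  [ffun r => if unlift ord0 r is Some r' then I r' else a].

Lemma fcons0 (T : Type) k (a : T) (I : {ffun 'I_k -> T}) : fcons a I ord0 = a.
Proof. by rewrite ffunE unlift_none. Qed.

Lemma fconsS (T : Type) k (a : T) (I : {ffun 'I_k -> T}) r :
  fcons a I (lift ord0 r) = I r.
Proof. by rewrite ffunE liftK. Qed.

Lemma sum_fcons k (T : finType) (H : {ffun 'I_k.+1 -> T} -> C) :
  \sum_I H I = \sum_a \sum_(I : {ffun 'I_k -> T}) H (fcons a I).
Proof.
pose f (p : T * {ffun 'I_k -> T}) := fcons p.1 p.2.
rewrite pair_bigA /= (reindex f) //; apply: onW_bij.
exists (fun I : {ffun 'I_k.+1 -> T} =>
  (I ord0, [ffun r => I (lift ord0 r)])) => [[a I]|I].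
  rewrite /f fcons0 /=; congr (_, _).
  by apply/ffunP => r; rewrite ffunE fconsS.
apply/ffunP => r; rewrite ffunE.
by case: unliftP => [r'|] -> //=; rewrite ffunE.
Qed.

(** Peeling the first index off both multi-indices follows the recursion of [form_ip], and [k!]
    splits into the factors met on the way. *)
Lemma ip_form_dot (M : 'M[R]_d) k F G :
  form_dot M (fun A : 'M[R]_(k, d) => F (rows A)) (fun A => G (rows A))
  = form_ip (invmx M) k F G.
Proof.
rewrite /form_dot; elim: k F G => [|k IH] F G.
  rewrite invr1 mul1r (eq_bigr (fun=> F [::] * (G [::])^*)) => [|I _].
    by rewrite sumr_const card_ffun !card_ord expn0.
  rewrite (eq_bigr (fun=> F [::] * (G [::])^*)) => [|J _].
    by rewrite sumr_const card_ffun !card_ord expn0.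
  by rewrite big_ord0 mul1r !(size0nil (size_rows _)).
rewrite factS natrM invfM [form_ip _ _ _ _]/= -mulrA; congr (_ * _).
rewrite sum_fcons mulr_sumr; apply: eq_bigr => a _.
rewrite (eq_bigr _ (fun I _ => sum_fcons _)) exchange_big mulr_sumr.
apply: eq_bigr => b _; rewrite -IH mulrCA; congr (_ * _); rewrite mulr_sumr.
apply: eq_bigr => I _; rewrite mulr_sumr; apply: eq_bigr => J _.
rewrite big_ord_recl !fcons0 rmorphM /=.
have rowsE (c : 'I_d) (K : {ffun 'I_k -> 'I_d}) :
    rows (rowsub (fcons c K) 1%:M)
    = delta_mx 0 c :: rows (rowsub K (1%:M : 'M[R]_d)).
  rewrite rowsS; congr (_ :: _); last congr rows.
    by apply/rowP => l; rewrite !mxE fcons0 eqxx /= eq_sym.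
  by apply/matrixP => r l; rewrite !mxE fconsS.
rewrite !rowsE /contract !mulrA; congr (_ * _ * _ * _).
by under eq_bigr => r _ do rewrite !fconsS.
Qed.

Lemma form_dot_ip (M : 'M[R]_d) k (a b : 'M[R]_(k, d) -> C) :
  form_dot M a b = form_ip (invmx M) k (list_form a) (list_form b).
Proof.
rewrite -ip_form_dot; congr form_dot; apply: funext => A;
by rewrite list_form_rows.
Qed.

Lemma lambda_op_low g xi (x : 'rV[R]_d) k (w : 'M[R]_(k, d) -> C) A :
  (k < 2)%N -> lambda_op g xi x w A = 0.
Proof. by case: k w A => [|[|]]. Qed.

(** The contraction [b] satisfies the defining adjunction by [ip_lef], so the choice in [lambda_op]
    does not fall back on its default 0; nondegeneracy then forces the chosen form to be [b]. *)
Lemma lambda_op_lam g xi (x : 'rV[R]_d) k (O : 'M[R]_d)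
    (w : 'M[R]_(k, d) -> C) A :
  O^T = - O -> (g x)^T = g x -> g x \in unitmx ->
  (forall B : 'M[R]_(2, d), 2^-1 * ext_deriv (eta g xi) x B
     = (row ord0 B *m O *m (row ord_max B)^T) 0 0) ->
  altform w ->
  lambda_op g xi x w A
  = lam (invmx (g x) *m O *m invmx (g x)) (list_form w) (rows A).
Proof.
move=> sO sG uG OE aw.
have [k2|] := ltnP k 2.
  rewrite lambda_op_low //; rewrite (lam_low _ _ k2) //.
  exact: homogeneous_list_form.
case: k w A aw => [|[|k]] // w A aw _.
set T := _ *m _ *m _.
have [mw alw hw] := kform_list_form aw.
have sGi : (invmx (g x))^T = invmx (g x) by rewrite trmx_inv sG.
pose b (B : 'M[R]_(k, d)) := lam T (list_form w) (rows B).
have adj (a : 'M[R]_(k, d) -> C) : altform a ->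
    form_dot (g x) (lefschetz g xi x a) w = form_dot (g x) a b.
  move=> aa; have [ma ala ha] := kform_list_form aa.
  rewrite !form_dot_ip list_formK; last exact: homogeneous_lam.
  rewrite -(ip_lef k sGi sO ma mw alw) -(list_formK (homogeneous_lef O ha)).
  congr form_ip; congr list_form; apply: funext => B.
  by apply: (wedge_lef _ sO) => // D; rewrite OE.
rewrite /lambda_op; case: xgetP => [c _ [ac cE]|]; last first.
  move=> /(_ b); case; split=> //.
  by apply: altform_rows; [exact: multilinear_lam|exact: alternating_lam].
suff /(congr1 (fun f => f (rows A))) :
    (fun s => lam T (list_form w) s - list_form c s) = fun=> 0.
  by rewrite list_form_rows => /eqP; rewrite subr_eq0 => /eqP.
have [mc alc hc] := kform_list_form ac.
have hl := homogeneous_lam T hw.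
apply: (@ip_nondegenerate _ _ (invmx (g x)) k _ sGi).
  by rewrite unitmx_inv.
  split.
  - move=> s1 u v r s2; rewrite (multilinear_lam _ mw) mc; ring.
  - by move=> s1 u s2; rewrite (alternating_lam _ alw) alc subrr.
  - by move=> s sk; rewrite hl // hc // subrr.
move=> F [mF alF hF].
have := adj _ (altform_rows k mF alF); rewrite cE; last exact: altform_rows.
rewrite !form_dot_ip !list_formK // => e.
have -> : (fun s => lam T (list_form w) s - list_form c s)
    = fun s => lam T (list_form w) s + (-1)%:C * list_form c s.
  by apply: funext => s; rewrite rmorphN rmorph1 mulN1r.
by rewrite ipDr -e rmorphN rmorph1 mulN1r subrr.
Qed.

End Wedge.

(** * Smooth functions *)

Section Smooth.
Variables (R : realType) (V : normedModType R).
Implicit Types (W : normedModType R) (U : set V).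

(** [g - f] is zero near [x], hence differentiable there with differential 0; adding it to [f] gives
    [g]. *)
Lemma near_eq_differentiable W (f g : V -> W) x :
  (\forall y \near x, f y = g y) -> differentiable f x -> differentiable g x.
Proof.
move=> fg df; suff dh : differentiable (fun y => g y - f y) x.
  have -> : g = f + (fun y => g y - f y).
    by apply: funext => y; rewrite !fctE addrC subrK.
  exact: differentiableD.
have o0 : (fun y => g y - f y) \o shift x
    = cst (g x - f x) + \0 +o_ (0 : V) id.
  apply/eqaddoP => e e0.
  have fgx : f x = g x by exact: nbhs_singleton fg.
  have : \forall y \near (0 : V), f (y + x) = g (y + x).
    by have := near_shift 0 x (fun y => f y = g y); rewrite subr0 /= => <-.
  apply: filterS => y /= fgy.
  rewrite !fctE /= fgy fgx !subrr addr0 subr0 normr0.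
  by rewrite mulr_ge0 // ltW.
apply/diff_locallyP.
have -> : ('d (fun y => g y - f y) x : V -> W) = \0.
  by apply/(@diff_unique _ _ _ _ \0 x) => //; exact: cst_continuous.
split=> //; exact: cst_continuous.
Qed.

Lemma eq_is_Ck W k U (f g : V -> W) : open U ->
  (forall x, U x -> f x = g x) -> is_Ck k U f -> is_Ck k U g.
Proof.
move=> oU; elim: k f g => [|k IH] f g fg /=.
  move=> cf x xU; have Ux : U x by rewrite inE in xU.
  have := cf x xU; rewrite /continuous_at -fg //; apply: cvg_trans.
  apply: near_eq_cvg; near do rewrite fg //.
  by apply: open_nbhs_nbhs.
move=> [df Df]; split=> [x Ux|v].
  have nfg : \forall y \near x, f y = g y.
    by near do rewrite fg //; apply: open_nbhs_nbhs.
  exact: near_eq_differentiable nfg (df x Ux).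
apply: (IH (fun x => 'D_v f x)) => // x Ux.
by apply: near_eq_derive; near do rewrite fg //; apply: open_nbhs_nbhs.
Unshelve. all: by end_near. Qed.

Lemma is_Ck_pred W k U (f : V -> W) : is_Ck k.+1 U f -> is_Ck k U f.
Proof.
elim: k f => [|k IH] f [df Df].
  move=> x xU; apply: differentiable_continuous.
  by apply: df; rewrite inE in xU.
by split=> // v; apply: IH.
Qed.

Lemma is_Ck_cst W k U (c : W) : is_Ck k U (fun=> c).
Proof.
elim: k c => [|k IH] c /=; first by move=> x _; exact: cvg_cst.
split=> [x _|v]; first exact: differentiable_cst.
have -> : (fun x => 'D_v (fun=> c) x) = fun=> 0.
  by apply: funext => x; exact: derive_cst.
exact: IH.
Qed.

Lemma is_CkD W k U (f g : V -> W) : open U ->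
  is_Ck k U f -> is_Ck k U g -> is_Ck k U (fun x => f x + g x).
Proof.
move=> oU; elim: k f g => [|k IH] f g /=.
  by move=> cf cg x xU; apply: cvgD; [exact: cf|exact: cg].
move=> [df Df] [dg Dg]; split=> [x Ux|v].
  by apply: differentiableD; [exact: df|exact: dg].
apply: eq_is_Ck (IH _ _ (Df v) (Dg v)) => // x Ux.
by rewrite deriveD //; apply: diff_derivable; [exact: df|exact: dg].
Qed.

(** The product rule involves [f] and [g] themselves, which therefore enter the induction at order
    [k] through [is_Ck_pred]. *)
Lemma is_CkM k U (f g : V -> R) : open U ->
  is_Ck k U f -> is_Ck k U g -> is_Ck k U (fun x => f x * g x).
Proof.
move=> oU; elim: k f g => [|k IH] f g.
  by move=> cf cg x xU; apply: cvgM; [exact: cf|exact: cg].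
move=> Cf Cg; have := is_Ck_pred Cf; have := is_Ck_pred Cg.
move: Cf Cg => [df Df] [dg Dg] Cg Cf; split=> [x Ux|v].
  by apply: differentiableM; [exact: df|exact: dg].
apply: eq_is_Ck (is_CkD oU (IH _ _ Cf (Dg v)) (IH _ _ Cg (Df v))) => // x Ux.
by rewrite deriveM //; apply: diff_derivable; [exact: df|exact: dg].
Qed.

(** A bootstrap: the derivative [- f^-2 'D_v f] is of class C^k as soon as [f^-1] is. *)
Lemma is_CkV k U (f : V -> R) : open U -> (forall x, U x -> f x != 0) ->
  is_Ck k U f -> is_Ck k U (fun x => (f x)^-1).
Proof.
move=> oU f0; elim: k => [|k IH] Cf.
  by move=> x xU; apply: cvgV; [apply: f0; rewrite inE in xU|exact: Cf].
have Ci := IH (is_Ck_pred Cf); move: Cf => [df Df]; split=> [x Ux|v].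
  by apply: differentiableV; [exact: df|exact: f0].
apply: eq_is_Ck (is_CkM oU (is_Ck_cst _ U (-1 : R))
   (is_CkM oU (is_CkM oU Ci Ci) (Df v))) => // x Ux.
rewrite deriveV; [|exact: f0|apply: diff_derivable; exact: df].
by rewrite mulN1r expr2 invfM -mulNr.
Qed.

Lemma differentiable_entry m n (f : V -> 'M[R]_(m, n)) x i j :
  differentiable f x -> differentiable (fun y => f y i j) x.
Proof.
move=> df.
apply: (@differentiable_comp _ _ _ _ f (fun N : 'M[R]_(m, n) => N i j)) => //.
exact: differentiable_coord.
Qed.

Lemma derive_entry m n (f : V -> 'M[R]_(m, n)) x v i j :
  differentiable f x -> 'D_v (fun y => f y i j) x = ('D_v f x) i j.
Proof.
move=> df; rewrite derive_mx ?mxE //; exact: diff_derivable.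
Qed.

Lemma is_Ck_entry m n k U (f : V -> 'M[R]_(m, n)) i j : open U ->
  is_Ck k U f -> is_Ck k U (fun x => f x i j).
Proof.
move=> oU; elim: k f => [|k IH] f /=.
  move=> cf x xU.
  apply: (@continuous_comp _ _ _ f (fun N : 'M[R]_(m, n) => N i j)).
    exact: cf.
  exact: coord_continuous.
move=> [df Df]; split=> [x Ux|v]; first exact/differentiable_entry/df.
apply: eq_is_Ck (IH _ (Df v)) => // x Ux.
by rewrite derive_entry //; apply: df.
Qed.

Lemma is_derive_line (f : V -> R) x u (s0 : R) :
  derivable f (x + s0 *: u) u ->
  is_derive s0 1 (fun s : R => f (x + s *: u)) ('D_u f (x + s0 *: u)).
Proof.
move=> df.
have E : (fun h : R =>
    h^-1 *: (((fun s : R => f (x + s *: u)) \o shift s0) (h *: 1)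
      - f (x + s0 *: u)))
    = (fun h : R => h^-1 *: ((f \o shift (x + s0 *: u)) (h *: u)
      - f (x + s0 *: u))).
  apply: funext => h /=; congr (_ *: (f _ - _)).
  by rewrite [h *: 1]mulr1 scalerDl addrCA addrA.
split; first by rewrite /derivable E.
by rewrite /derive E.
Qed.

Lemma mvt_line (f : V -> R) x u (h : R) : 0 < h ->
  (forall s, 0 <= s <= h -> derivable f (x + s *: u) u) ->
  exists2 s, 0 <= s <= h & f (x + h *: u) - f x = h * 'D_u f (x + s *: u).
Proof.
move=> h0 df; pose g (s : R) := f (x + s *: u).
have dg s : 0 <= s <= h -> is_derive s 1 g ('D_u f (x + s *: u)).
  by move=> sh; exact/is_derive_line/df.
have [||s] := @MVT R g (fun s => 'D_u f (x + s *: u)) 0 h h0.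
- by move=> s; rewrite in_itv /= => /andP[? ?]; apply: dg; rewrite !ltW.
- apply: continuous_in_subspaceT => s; rewrite inE /= in_itv /= => /dg [+ _].
  by move/derivable1_diffP/differentiable_continuous.
- rewrite in_itv /= => /andP[s0 sh]; rewrite /g scale0r addr0 subr0 mulrC => e.
  by exists s; rewrite ?ltW.
Qed.

Lemma translate_quotient (f : V -> R) c u x :
  (fun h : R => h^-1 *: (((fun y => f (y + c)) \o shift x) (h *: u)
     - f (x + c)))
  = (fun h : R => h^-1 *: ((f \o shift (x + c)) (h *: u) - f (x + c))).
Proof. by apply: funext => h /=; rewrite addrA. Qed.

Lemma derive_translate (f : V -> R) c u x :
  'D_u (fun y => f (y + c)) x = 'D_u f (x + c).
Proof. by rewrite /derive translate_quotient. Qed.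

Lemma derivable_translate (f : V -> R) c u x :
  derivable f (x + c) u -> derivable (fun y => f (y + c)) x u.
Proof. by rewrite /derivable translate_quotient. Qed.

(** The mean value theorem along [u] for [y |-> f (y + h v) - f y], then along [v] for ['D_u f]. *)
Lemma second_difference (f : V -> R) x u v (h : R) : 0 < h ->
  (forall s t, 0 <= s <= h -> 0 <= t <= h ->
    differentiable f (x + s *: u + t *: v) /\
    differentiable ('D_u f) (x + s *: u + t *: v)) ->
  exists s t, [/\ 0 <= s <= h, 0 <= t <= h &
    f (x + h *: u + h *: v) - f (x + h *: u) - (f (x + h *: v) - f x)
    = h * (h * 'D_v ('D_u f) (x + s *: u + t *: v))].
Proof.
move=> h0 df; have hh : 0 <= h <= h by rewrite ltW /=.
have h00 : 0 <= (0 : R) <= h by rewrite lexx ltW.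
have d0 s : 0 <= s <= h -> derivable f (x + s *: u) u.
  move=> sh; have [+ _] := df s 0 sh h00.
  by rewrite scale0r addr0 => /diff_derivable.
have d1 s : 0 <= s <= h -> derivable (fun y => f (y + h *: v)) (x + s *: u) u.
  move=> sh; apply: derivable_translate; apply: diff_derivable.
  by case: (df s h sh hh).
have [s sh Es] := @mvt_line (fun y => f (y + h *: v) - f y) x u h h0
  (fun s sh => derivableB (d1 s sh) (d0 s sh)).
have [t th Et] := @mvt_line ('D_u f) (x + s *: u) v h h0
  (fun t th => diff_derivable (df s t sh th).2).
exists s, t; split=> //; rewrite -Et Es; congr (_ * _).
by rewrite deriveB ?derive_translate //; [exact: d1|exact: d0].
Qed.

Lemma half_dist_absurd (a b q : R) :
  `|a - q| < `|a - b| / 2 -> `|b - q| < `|a - b| / 2 -> False.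
Proof.
move=> aq bq; have := ltrD aq bq; rewrite -splitr ltNge => /negP; apply.
by rewrite (distrC b q) ler_distD.
Qed.

(** The second difference over a parallelogram is symmetric in [u] and [v], so the two mixed
    derivatives take a common value at two points of the parallelogram. For a small one this
    contradicts their continuity if they differ at [x]. *)
Lemma schwarz (f : V -> R) U x u v : open U -> smooth_on U f -> U x ->
  'D_v ('D_u f) x = 'D_u ('D_v f) x.
Proof.
move=> oU sf Ux; apply/eqP; rewrite -subr_eq0 -normr_eq0.
apply/negPn/negP => ne0; pose e := `|'D_v ('D_u f) x - 'D_u ('D_v f) x| / 2.
have e0 : 0 < e by rewrite divr_gt0 // lt_def ne0 /=.
have cont a b : {for x, continuous ('D_b ('D_a f))}.
  have [_ /(_ a) [_ /(_ b)]] := sf 2; apply; by rewrite inE.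
have near_lt a b :
    \forall y \near x, `|'D_b ('D_a f) x - 'D_b ('D_a f) y| < e.
  by have /cvgrPdist_lt := cont a b; apply.
have nU : \forall y \near x, U y by exact: open_nbhs_nbhs.
have [r /= r0 B] : exists2 r : R, 0 < r & forall y, ball x r y ->
    U y /\ (`|'D_v ('D_u f) x - 'D_v ('D_u f) y| < e
    /\ `|'D_u ('D_v f) x - 'D_u ('D_v f) y| < e).
  by apply/nbhs_ballP; exact: filterI nU (filterI (near_lt u v) (near_lt v u)).
(* All [x + s u + t v] with [0 <= s, t <= h] lie within [h c = r / 2] of [x]; the summand 1 keeps
   [c] positive. *)
pose c := `|u| + `|v| + 1; have c0 : 0 < c by rewrite ltr_wpDl // addr_ge0.
pose h := r / 2 / c; have h0 : 0 < h by rewrite !divr_gt0.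
have near_x s t : 0 <= s <= h -> 0 <= t <= h ->
    ball x r (x + s *: u + t *: v).
  move=> /andP[s0 sh] /andP[t0 th].
  rewrite -ball_normE /= -addrA opprD addrA subrr sub0r normrN.
  apply: le_lt_trans (ler_normD _ _) _; rewrite !normrZ !ger0_norm //.
  apply: (@le_lt_trans _ _ (h * c)); last first.
    by rewrite /h divfK ?gt_eqF // ltr_pdivrMr // ltr_pMr // ltr1n.
  rewrite /c !mulrDr mulr1 -[leLHS]addr0 lerD ?(ltW h0) // lerD //;
    by rewrite ler_wpM2r.
clearbody h.
have df a b : U b -> differentiable f b /\ differentiable ('D_a f) b.
  move=> Ub; split; first by have [+ _] := sf 1; apply.
  by have [_ /(_ a) [+ _]] := sf 2; apply.
have [s [t [sh th E1]]] := second_difference h0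
  (fun s t sh th => df u _ (B _ (near_x s t sh th)).1).
have near_x' a b : 0 <= a <= h -> 0 <= b <= h ->
    ball x r (x + a *: v + b *: u).
  by move=> th' sh'; rewrite addrAC; exact: near_x.
have [t' [s' [th' sh' E2]]] := second_difference h0
  (fun s t sh th => df v _ (B _ (near_x' s t sh th)).1).
have E : 'D_v ('D_u f) (x + s *: u + t *: v)
    = 'D_u ('D_v f) (x + t' *: v + s' *: u).
  have h_neq0 : h != 0 by rewrite gt_eqF.
  suff /(mulfI h_neq0) /(mulfI h_neq0) : h * (h * 'D_v ('D_u f)
      (x + s *: u + t *: v)) = h * (h * 'D_u ('D_v f) (x + t' *: v + s' *: u)).
    by [].
  apply: etrans (esym E1) _; apply: etrans _ E2.
  by rewrite [x + h *: v + _]addrAC; ring.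
have := (B _ (near_x _ _ sh th)).2.1; rewrite E => b1.
exact: half_dist_absurd b1 (B _ (near_x' _ _ th' sh')).2.2.
Qed.

End Smooth.

(** * Smooth matrices and smooth families of forms *)

Section SmoothScalars.
Variables (R : realType) (d : nat) (U : set 'rV[R]_d).
Hypothesis oU : open U.
Local Notation V := 'rV[R]_d.
Local Notation C := R[i].
Implicit Types f g : V -> R.

Lemma eq_smooth f g : (forall x, U x -> f x = g x) ->
  smooth_on U f -> smooth_on U g.
Proof. by move=> fg sf k; exact: eq_is_Ck (sf k). Qed.

Lemma smooth_cst (c : R) : smooth_on U (fun _ : V => c).
Proof. by move=> k; exact: is_Ck_cst. Qed.

Lemma smoothD f g : smooth_on U f -> smooth_on U g ->
  smooth_on U (fun x => f x + g x).
Proof. by move=> sf sg k; exact: is_CkD. Qed.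

Lemma smoothM f g : smooth_on U f -> smooth_on U g ->
  smooth_on U (fun x => f x * g x).
Proof. by move=> sf sg k; exact: is_CkM. Qed.

Lemma smoothN f : smooth_on U f -> smooth_on U (fun x => - f x).
Proof.
move=> sf; apply: eq_smooth (smoothM (smooth_cst (-1)) sf) => x _.
by rewrite mulN1r.
Qed.

Lemma smoothV f : (forall x, U x -> f x != 0) -> smooth_on U f ->
  smooth_on U (fun x => (f x)^-1).
Proof. by move=> f0 sf k; exact: is_CkV. Qed.

Lemma smooth_sum I (r : seq I) (P : pred I) (f : I -> V -> R) :
  (forall i, smooth_on U (f i)) ->
  smooth_on U (fun x => \sum_(i <- r | P i) f i x).
Proof.
move=> sf; elim: r => [|i r IH].
  by apply: eq_smooth (smooth_cst 0) => x _; rewrite big_nil.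
have [Pi|nPi] := boolP (P i).
  by apply: eq_smooth (smoothD (sf i) IH) => x _; rewrite big_cons Pi.
by apply: eq_smooth IH => x _; rewrite big_cons (negPf nPi).
Qed.

Lemma smooth_prod I (r : seq I) (f : I -> V -> R) :
  (forall i, smooth_on U (f i)) ->
  smooth_on U (fun x => \prod_(i <- r) f i x).
Proof.
move=> sf; elim: r => [|i r IH].
  by apply: eq_smooth (smooth_cst 1) => x _; rewrite big_nil.
by apply: eq_smooth (smoothM (sf i) IH) => x _; rewrite big_cons.
Qed.

Lemma smooth_derive f v : smooth_on U f -> smooth_on U ('D_v f).
Proof. by move=> sf k; have [_] := sf k.+1; exact. Qed.

Lemma smooth_differentiable (W : normedModType R) (f : V -> W) x :
  smooth_on U f -> U x -> differentiable f x.
Proof. by move=> sf; have [+ _] := sf 1; exact. Qed.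

(** Smoothness is taken entry by entry, so that products, determinants and inverses reduce to the
    algebra of scalar functions. *)
Definition smooth_mx m n (f : V -> 'M[R]_(m, n)) :=
  forall i j, smooth_on U (fun x => f x i j).

Lemma smooth_entries m n (f : V -> 'M[R]_(m, n)) :
  smooth_on U f -> smooth_mx f.
Proof. by move=> sf i j k; exact: is_Ck_entry. Qed.

Lemma smooth_mul m n p (f : V -> 'M[R]_(m, n)) (g : V -> 'M[R]_(n, p)) :
  smooth_mx f -> smooth_mx g -> smooth_mx (fun x => f x *m g x).
Proof.
move=> sf sg i j.
have := smooth_sum (index_enum 'I_n) xpredT
  (fun k => smoothM (sf i k) (sg k j)).
by apply: eq_smooth => x _; rewrite mxE.
Qed.

Lemma smooth_tr m n (f : V -> 'M[R]_(m, n)) :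
  smooth_mx f -> smooth_mx (fun x => (f x)^T).
Proof. by move=> sf i j; apply: eq_smooth (sf j i) => x _; rewrite mxE. Qed.

Lemma smooth_mx_cst m n (M : 'M[R]_(m, n)) : smooth_mx (fun=> M).
Proof. by move=> i j; exact: smooth_cst. Qed.

Lemma smooth_det n (f : V -> 'M[R]_n) : smooth_mx f ->
  smooth_on U (fun x => \det (f x)).
Proof.
move=> sf; apply: smooth_sum => s; apply: smoothM; first exact: smooth_cst.
by apply: smooth_prod => i; exact: sf.
Qed.

(** Cramer's rule: the adjugate divided by the determinant. *)
Lemma smooth_invmx n (f : V -> 'M[R]_n) : smooth_mx f ->
  (forall x, U x -> f x \in unitmx) -> smooth_mx (fun x => invmx (f x)).
Proof.
move=> sf uf i j.
have sc : smooth_on U (fun x => cofactor (f x) j i).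
  apply: smoothM; first exact: smooth_cst.
  apply: smooth_det => a b; apply: eq_smooth (sf (lift j a) (lift i b)) => x _.
  by rewrite !mxE.
have det0 x : U x -> \det (f x) != 0 by move/uf; rewrite unitmxE unitfE.
have sd := smoothV det0 (smooth_det sf).
apply: eq_smooth (smoothM sd sc) => x Ux.
by rewrite /invmx uf // !mxE.
Qed.

Definition csmooth (f : V -> C) :=
  smooth_on U (fun x => complex.Re (f x)) /\
  smooth_on U (fun x => complex.Im (f x)).

Lemma eq_csmooth (f g : V -> C) : (forall x, U x -> f x = g x) ->
  csmooth f -> csmooth g.
Proof.
by move=> fg [sr si]; split; [apply: eq_smooth sr|apply: eq_smooth si];
  move=> x Ux; rewrite fg.
Qed.

Lemma csmooth0 : csmooth (fun=> 0).
Proof. by split; exact: smooth_cst. Qed.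

Lemma csmoothD (f g : V -> C) : csmooth f -> csmooth g ->
  csmooth (fun x => f x + g x).
Proof.
move=> [fr fi] [gr gi]; split.
  by apply: eq_smooth (smoothD fr gr) => x _; rewrite raddfD.
by apply: eq_smooth (smoothD fi gi) => x _; rewrite raddfD.
Qed.

Lemma csmoothZ (r : V -> R) (f : V -> C) : smooth_on U r -> csmooth f ->
  csmooth (fun x => (r x)%:C * f x).
Proof.
move=> sr [fr fi]; split.
  apply: eq_smooth (smoothM sr fr) => x _.
  by case: (f x) => a b /=; rewrite mul0r subr0.
apply: eq_smooth (smoothM sr fi) => x _.
by case: (f x) => a b /=; rewrite mul0r addr0.
Qed.

Lemma csmoothB (f g : V -> C) : csmooth f -> csmooth g ->
  csmooth (fun x => f x - g x).
Proof.
move=> sf sg; apply: eq_csmooth (csmoothD sf (csmoothZ (smooth_cst (-1)) sg)).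
by move=> x _; rewrite rmorphN rmorph1 mulN1r.
Qed.

Lemma csmooth_sum I (r : seq I) (f : I -> V -> C) :
  (forall i, csmooth (f i)) -> csmooth (fun x => \sum_(i <- r) f i x).
Proof.
move=> sf; elim: r => [|i r IH].
  by apply: eq_csmooth csmooth0 => x _; rewrite big_nil.
by apply: eq_csmooth (csmoothD (sf i) IH) => x _; rewrite big_cons.
Qed.

Definition smooth_form (F : V -> seq V -> C) :=
  forall s, csmooth (fun x => F x s).

Lemma smooth_form_ext (c : V -> 'cV[R]_d) F : smooth_mx c -> smooth_form F ->
  smooth_form (fun x => ext (c x) (F x)).
Proof.
move=> sc sF s; elim: s F sF => [|v s IH] F sF; first exact: csmooth0.
apply: csmoothB.
  apply: csmoothZ; last exact: sF.
  exact: (smooth_mul (smooth_mx_cst v) sc).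
by apply: (IH (fun x => contract v (F x))) => t; exact: sF.
Qed.

Lemma smooth_form_lef (O : V -> 'M[R]_d) F : smooth_mx O -> smooth_form F ->
  smooth_form (fun x => lef (O x) (F x)).
Proof.
move=> sO sF s; elim: s F sF => [|v s IH] F sF; first exact: csmooth0.
apply: csmoothD.
  by apply: (IH (fun x => contract v (F x))) => t; exact: sF.
apply: (@smooth_form_ext (fun x => (v *m O x)^T)) => //; apply: smooth_tr.
exact: smooth_mul (smooth_mx_cst v) sO.
Qed.

Lemma smooth_form_lam (T : V -> 'M[R]_d) F : smooth_mx T -> smooth_form F ->
  smooth_form (fun x => lam (T x) (F x)).
Proof.
move=> sT sF s; rewrite /lam.
have -> : 2^-1 = (2^-1 : R)%:C by rewrite fmorphV rmorph_nat.
apply: csmoothZ; first exact: smooth_cst.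
apply: csmooth_sum => a; apply: csmooth_sum => b.
by apply: csmoothZ; [exact: sT|exact: sF].
Qed.

(** [smooth_form] tests constant vectors only, while [v x] moves with the point; multilinearity
    expands it in the constant basis with smooth coefficients. *)
Lemma smooth_form_vert (e : V -> 'cV[R]_d) (v : V -> V) F :
  smooth_mx e -> smooth_mx v -> smooth_form F ->
  (forall x, U x -> multilinear (F x)) ->
  smooth_form (fun x => vert (e x) (v x) (F x)).
Proof.
move=> se sv sF mF s.
have sG : smooth_form (fun x t =>
    \sum_b (v x 0 b)%:C * F x (delta_mx 0 b :: t)).
  by move=> t; apply: csmooth_sum => b; apply: csmoothZ; [exact: sv|exact: sF].
apply: eq_csmooth (smooth_form_ext se sG s) => x Ux; rewrite /vert; congr ext.
by rewrite (contract_sum _ (mF x Ux)).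
Qed.

End SmoothScalars.

(** * The contact structure in a chart *)

Section LocalContact.
Variables (R : realType) (d : nat) (U : set 'rV[R]_d).
Hypothesis oU : open U.
Local Notation V := 'rV[R]_d.
Implicit Types (f : V -> R).

Lemma derive_basis f x v : differentiable f x ->
  'D_v f x = \sum_a v 0 a * 'D_(basis_vec R a) f x.
Proof.
move=> df; rewrite deriveE // {1}[v]row_sum_delta linear_sum.
by apply: eq_bigr => a _; rewrite linearZ deriveE.
Qed.

Lemma eq_derive_on f (h : V -> R) v x : (forall y, U y -> f y = h y) -> U x ->
  'D_v f x = 'D_v h x.
Proof.
move=> fh Ux; apply: near_eq_derive.
by near do rewrite fh //; exact: open_nbhs_nbhs.
Unshelve. all: by end_near. Qed.

Lemma derive_suml (f : 'I_d -> V -> R) (c : 'I_d -> R) x v :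
  (forall b, differentiable (f b) x) ->
  'D_v (fun y => \sum_b c b * f b y) x = \sum_b c b * 'D_v (f b) x.
Proof.
move=> df.
have -> : (fun y => \sum_b c b * f b y) = \sum_b (c b \*: f b).
  by apply: funext => y; rewrite fct_sumE.
have dbl b : derivable (c b \*: f b) x v.
  by apply: derivableZ; exact: diff_derivable.
rewrite derive_sum //; apply: eq_bigr => b _.
by rewrite deriveZ //; exact: diff_derivable.
Qed.

Variables (g : V -> 'M[R]_d) (xi : V -> V).
Hypothesis sg : smooth_mx U g.
Hypothesis sxi : smooth_mx U xi.

Definition eta_col (x : V) : 'cV[R]_d := g x *m (xi x)^T.

(** Only the partial derivatives of the components of eta; the exterior derivative is their
    antisymmetrisation, taken in [half_deta]. *)
Definition deta (x : V) : 'M[R]_d :=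
  \matrix_(a, b) 'D_(basis_vec R a) (fun y => eta_col y b 0) x.

Definition half_deta (x : V) : 'M[R]_d := 2^-1 *: (deta x - (deta x)^T).

Lemma smooth_eta_col : smooth_mx U eta_col.
Proof. exact/(smooth_mul oU)/(smooth_tr oU). Qed.

Lemma smooth_half_deta : smooth_mx U half_deta.
Proof.
move=> a b; have se i j := smooth_derive (basis_vec R j) (smooth_eta_col i 0).
have := smoothM oU (smooth_cst U (2^-1))
  (smoothD oU (se b a) (smoothN oU (se a b))).
by apply: eq_smooth => // x _; rewrite !mxE.
Qed.

Lemma half_deta_skew x : (half_deta x)^T = - half_deta x.
Proof. by rewrite /half_deta linearZ /= linearB /= trmxK -scalerN opprB. Qed.

Lemma etaE x v : eta g xi x v = \sum_b v 0 b * eta_col x b 0.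
Proof. by rewrite /eta /gdot /eta_col -mulmxA mxE. Qed.

Lemma derive_eta x u v : U x ->
  'D_u (fun y => eta g xi y v) x = (u *m deta x *m v^T) 0 0.
Proof.
move=> Ux.
have de b : differentiable (fun y => eta_col y b 0) x.
  exact: smooth_differentiable (smooth_eta_col b 0) Ux.
have -> : (fun y => eta g xi y v) = fun y => \sum_b v 0 b * eta_col y b 0.
  by apply: funext => y; exact: etaE.
rewrite derive_suml // mxE; apply: eq_bigr => b _.
rewrite derive_basis // !mxE mulrC; congr (_ * _).
by apply: eq_bigr => a _; rewrite mxE.
Qed.

Lemma ext_deriv_eta x (B : 'M[R]_(2, d)) : U x ->
  2^-1 * ext_deriv (eta g xi) x B
  = (row ord0 B *m half_deta x *m (row ord_max B)^T) 0 0.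
Proof.
move=> Ux; rewrite /ext_deriv big_ord_recl big_ord1 expr0 mul1r expr1 mulN1r.
have -> : row' ord0 B = row ord_max B.
  by apply/rowP => l; rewrite !mxE; congr (B _ _); apply: val_inj.
have -> : lift ord0 ord0 = ord_max :> 'I_2 by apply: val_inj.
have -> : row' ord_max B = row ord0 B.
  by apply/rowP => l; rewrite !mxE; congr (B _ _); apply: val_inj.
rewrite !derive_eta // /half_deta -scalemxAr -scalemxAl mulmxBr mulmxBl.
rewrite [in RHS]mxE; congr (_ * _); rewrite [in RHS]mxE; congr (_ + _).
rewrite [in RHS]mxE; congr (- _).
rewrite -[in RHS](trmxK (row ord0 B)) -!trmx_mul [in RHS]mxE.
by rewrite mulmxA.
Qed.

Hypothesis gsym : forall x, U x -> (g x)^T = g x.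
Hypothesis gpos : forall x, U x -> forall v : V, v != 0 ->
  0 < (v *m g x *m v^T) 0 0.

Lemma metric_unit x : U x -> g x \in unitmx.
Proof.
move=> Ux; rewrite -row_free_unit -kermx_eq0; apply/eqP/row_matrixP => i.
rewrite row0; apply/eqP/negPn/negP => /(gpos Ux).
by rewrite -row_mul mulmx_ker row0 mul0mx mxE ltxx.
Qed.

Definition nabla_mx (x : V) : 'M[R]_d :=
  \matrix_(a, k) ('D_(basis_vec R a) (fun y => xi y 0 k) x
    + \sum_b xi x 0 b * christoffel g x a b k).

Hypothesis dxi : forall x, U x -> differentiable xi x.

Lemma phi_mx x v : U x -> phi g xi x v = v *m nabla_mx x.
Proof.
move=> Ux; apply/rowP => k; rewrite /phi /nabla !mxE.
rewrite -(derive_entry _ _ _ (dxi Ux)) derive_basis; last first.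
  exact: differentiable_entry (dxi Ux).
rewrite -big_split; apply: eq_bigr => a _; rewrite !mxE mulrDr mulr_sumr /=.
by congr (_ + _); apply: eq_bigr => b _; rewrite mulrA.
Qed.

Lemma christoffel_lower x a b c : U x ->
  \sum_k christoffel g x a b k * g x k c
  = 2^-1 * ('D_(basis_vec R a) (fun y => g y b c) x
     + 'D_(basis_vec R b) (fun y => g y a c) x
     - 'D_(basis_vec R c) (fun y => g y a b) x).
Proof.
move=> Ux; pose t l := 'D_(basis_vec R a) (fun y => g y b l) x
     + 'D_(basis_vec R b) (fun y => g y a l) x
     - 'D_(basis_vec R l) (fun y => g y a b) x.
rewrite -/(t c) /christoffel.
under eq_bigr => k _ do rewrite -mulrA.
rewrite -mulr_sumr; congr (_ * _).
under eq_bigr => k _ do rewrite mulr_suml.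
rewrite exchange_big /=.
transitivity (\sum_l t l * (1%:M : 'M[R]_d) c l).
  apply: eq_bigr => l _; rewrite -(mulmxV (metric_unit Ux)) mxE mulr_sumr.
  apply: eq_bigr => k _; rewrite -/(t l).
  have -> : g x c k = g x k c by rewrite -[in LHS](gsym Ux) mxE.
  by ring.
rewrite (bigD1 c) //= big1 ?addr0 => [|l lc]; first by rewrite mxE eqxx mulr1.
by rewrite mxE eq_sym (negPf lc) mulr0.
Qed.

Hypothesis killing : forall x, U x -> forall v w, lie_metric g xi x v w = 0.

(** Once the upper index of the Christoffel symbols is lowered, [xi^b d_b g_ac] is the term that the
    Killing equation [K] expresses through first derivatives of [xi]; what is left is
    [(d_a eta_c - d_c eta_a) / 2]. *)
Lemma nabla_half_deta x : U x -> nabla_mx x *m g x = half_deta x.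
Proof.
move=> Ux; apply/matrixP => a c.
have dg i j : differentiable (fun y => g y i j) x.
  exact: smooth_differentiable (sg i j) Ux.
have dx k : differentiable (fun y => xi y 0 k) x.
  exact: differentiable_entry (dxi Ux).
pose e := basis_vec R (d := d).
pose dxk i k := 'D_(e i) (fun y => xi y 0 k) x.
pose dgk i j k := 'D_(e i) (fun y => g y j k) x.
have gs i j : g x i j = g x j i by rewrite -[in LHS](gsym Ux) mxE.
have dgs i j k : dgk i j k = dgk i k j.
  by apply: eq_derive_on => // y Uy; rewrite -[in LHS](gsym Uy) mxE.
have dE i j : deta x i j
    = \sum_k g x j k * dxk i k + \sum_k xi x 0 k * dgk i j k.
  rewrite mxE.
  have -> : (fun y => eta_col y j 0)
      = \sum_k ((fun y => g y j k) * (fun y => xi y 0 k)).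
    by apply: funext => y; rewrite fct_sumE mxE; apply: eq_bigr => k _;
      rewrite !mxE.
  rewrite derive_sum => [|k]; last first.
    by apply: derivableM; exact: diff_derivable.
  rewrite -big_split; apply: eq_bigr => k _ /=.
  by rewrite deriveM //; exact: diff_derivable.
have K : \sum_b xi x 0 b * dgk b a c
    + \sum_k dxk a k * g x k c + \sum_k g x a k * dxk c k = 0.
  rewrite -[RHS](killing Ux (e a) (e c)) /lie_metric /gdot.
  have gE y i j : (e i *m g y *m (e j)^T) 0 0 = g y i j.
    by rewrite /e /basis_vec trmx_delta -rowE -colE !mxE.
  congr (_ + _ + _).
  - have -> : (fun y => (e a *m g y *m (e c)^T) 0 0) = (fun y => g y a c).
      by apply: funext => y; rewrite gE.
    by rewrite derive_basis.
  - rewrite /e /basis_vec trmx_delta -colE !mxE; apply: eq_bigr => k _.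
    by rewrite -(derive_entry _ _ _ (dxi Ux)).
  - rewrite /e /basis_vec -rowE !mxE; apply: eq_bigr => k _.
    by rewrite !mxE -(derive_entry _ _ _ (dxi Ux)).
have -> : (nabla_mx x *m g x) a c = \sum_k dxk a k * g x k c
    + 2^-1 * (\sum_b xi x 0 b * dgk a b c + \sum_b xi x 0 b * dgk b a c
    - \sum_b xi x 0 b * dgk c a b).
  rewrite mxE; under eq_bigr => k _ do rewrite mxE mulrDl mulr_suml.
  rewrite big_split /=; congr (_ + _); rewrite exchange_big /=.
  rewrite -!big_split -sumrB mulr_sumr; apply: eq_bigr => b _ /=.
  under eq_bigr => k _ do rewrite -mulrA.
  rewrite -mulr_sumr christoffel_lower //.
  rewrite -/(dgk a b c) -/(dgk b a c) -/(dgk c a b); ring.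
have -> : half_deta x a c = 2^-1 * (deta x a c - deta x c a) by rewrite !mxE.
rewrite !dE.
have -> : \sum_k g x c k * dxk a k = \sum_k dxk a k * g x k c.
  by apply: eq_bigr => k _; rewrite gs; exact: mulrC.
have -> : \sum_b xi x 0 b * dgk a b c = \sum_b xi x 0 b * dgk a c b.
  by apply: eq_bigr => k _; rewrite dgs.
move: K => /eqP; rewrite -addrA addr_eq0 => /eqP ->.
by field.
Qed.

Lemma half_deta_contact n x : d = n.*2.+1 -> U x ->
  gdot (g x) (xi x) (xi x) = 1 ->
  (forall v, phi g xi x (phi g xi x v) = - v + eta g xi x v *: xi x) ->
  contact_algebra n (half_deta x)
    (invmx (g x) *m half_deta x *m invmx (g x)) (xi x) (eta_col x).
Proof.
move=> dn Ux xi1 phi2.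
pose G := g x; pose O := half_deta x; pose F := nabla_mx x.
have uG : G \in unitmx := metric_unit Ux.
have sG : G^T = G := gsym Ux.
have FG : F *m G = O := nabla_half_deta Ux.
have sO : O^T = - O := half_deta_skew x.
have sGi : (invmx G)^T = invmx G by rewrite trmx_inv sG.
have xe : xi x *m eta_col x = 1%:M.
  by apply/matrixP => i j; rewrite !ord1 /eta_col mulmxA [LHS]xi1 mxE.
have FF : F *m F = - 1%:M + eta_col x *m xi x.
  apply/row_matrixP => i; rewrite !rowE mulmxA -!phi_mx // phi2.
  rewrite mulmxDr mulmxN mulmx1; congr (_ + _).
  rewrite etaE -mul_scalar_mx mulmxA; congr (_ *m _).
  by apply/matrixP => a b; rewrite !ord1 !mxE eqxx mulr1n.
(* [phi xi = 0]: as [O] is skew, the squared length of [phi xi] is [- g(phi (phi xi), xi)], and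
   [phi (phi xi) = - xi + eta(xi) xi = 0]. *)
have xF : xi x *m F = 0.
  apply/eqP/negPn/negP => /(gpos Ux); rewrite -/G -[_ *m F *m G]mulmxA FG.
  have -> : xi x *m O *m (xi x *m F)^T = - (xi x *m F *m F *m G *m (xi x)^T)^T.
    rewrite -(mulmxA _ F G) FG [in RHS]trmx_mul trmxK (trmx_mul _ O) sO.
    by rewrite mulNmx mulmxN opprK mulmxA.
  rewrite -(mulmxA (xi x) F F) FF mulmxDr mulmxN mulmx1 mulmxA xe mul1mx addNr.
  by rewrite !mul0mx trmx0 oppr0 mxE ltxx.
have xO : xi x *m O = 0 by rewrite -FG mulmxA xF mul0mx.
have sT : (invmx G *m O *m invmx G)^T = - (invmx G *m O *m invmx G).
  by rewrite !trmx_mul sGi sO mulNmx mulmxN mulmxA.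
split=> //.
- rewrite /eta_col -/G mulmxA mulmxKV // -mulmxA.
  have -> : O *m (xi x)^T = - (xi x *m O)^T by rewrite trmx_mul sO mulNmx opprK.
  by rewrite xO trmx0 oppr0 mulmx0.
(* With [O = F G] the product is [- G^-1 F^2 G], so [phi2], conjugated by the metric, gives the
   projection. *)
- rewrite sT -/O -FG mulNmx !mulmxA mulmxK // -(mulmxA (invmx G) F F) FF.
  rewrite mulmxDr mulmxDl mulmxN mulmx1 mulNmx mulVmx // opprD opprK.
  by rewrite /eta_col -/G !mulmxA mulVmx // mul1mx trmx_mul trmxK sG mulmxA.
Qed.

End LocalContact.

(** * Change of chart *)

Section Pullback.
Variables (R : rcfType) (d : nat).
Local Notation V := 'rV[R]_d.
Local Notation C := R[i].
Implicit Types (F : seq V -> C) (J : 'M[R]_d) (s : seq V).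

Definition jmap J s := [seq v *m J | v <- s].

Definition pullback J F : seq V -> C := fun s => F (jmap J s).

Lemma ext_pull J c F s : ext (J *m c) (pullback J F) s = ext c F (jmap J s).
Proof.
elim: s F => [//|v s IH] F /=.
by rewrite (IH (contract (v *m J) F)) /pairing !mulmxA.
Qed.

Lemma lef_pull J O F s :
  lef (J *m O *m J^T) (pullback J F) s = lef O F (jmap J s).
Proof.
elim: s F => [//|v s IH] F /=; rewrite (IH (contract (v *m J) F)).
have -> : (v *m (J *m O *m J^T))^T = J *m (v *m J *m O)^T.
  by rewrite !trmx_mul !trmxK !mulmxA.
by rewrite ext_pull.
Qed.

(** The vectors [e_a *m J] fed to [F] are expanded in the basis again by multilinearity; this turns
    [T] into [J^T *m T *m J], the law of a contravariant tensor. *)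
Lemma lam_pull J T F s : multilinear F ->
  lam T (pullback J F) s = lam (J^T *m T *m J) F (jmap J s).
Proof.
move=> mF; rewrite /lam; congr (_ * _).
transitivity (\sum_a \sum_b \sum_k \sum_l ((T a b * J a k * J b l)%:C *
    F [:: delta_mx 0 k, delta_mx 0 l & jmap J s])).
  apply: eq_bigr => a _; apply: eq_bigr => b _.
  have := multilinear_basis [::] (delta_mx 0 a *m J)
    (delta_mx 0 b *m J :: jmap J s) mF.
  rewrite /pullback /= => ->; rewrite mulr_sumr; apply: eq_bigr => k _.
  rewrite (multilinear_basis [:: _] _ _ mF) !mulr_sumr; apply: eq_bigr => l _.
  by rewrite -!rowE !mxE !rmorphM /=; ring.
rewrite exchange_big /=; under eq_bigr => b _ do rewrite exchange_big /=.
rewrite exchange_big /=; apply: eq_bigr => k _.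
transitivity (\sum_l \sum_b \sum_a ((T a b * J a k * J b l)%:C *
    F [:: delta_mx 0 k, delta_mx 0 l & jmap J s])).
  rewrite [RHS]exchange_big /=; apply: eq_bigr => b _; exact: exchange_big.
apply: eq_bigr => l _; rewrite mxE rmorph_sum mulr_suml.
apply: eq_bigr => b _; rewrite mxE mulr_suml rmorph_sum mulr_suml.
by apply: eq_bigr => a _; rewrite mxE [J a k * _]mulrC.
Qed.

Lemma vert_pull J e v F s :
  vert (J *m e) v (pullback J F) s = vert e (v *m J) F (jmap J s).
Proof. exact: (ext_pull J e (contract (v *m J) F)). Qed.

End Pullback.

(** * Tensoriality of d eta *)

Section Covariance.
Variables (R : realType) (d : nat).
Local Notation V := 'rV[R]_d.

Lemma derive_comp (c : V -> V) (f : V -> R) x v :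
  differentiable c x -> differentiable f (c x) ->
  'D_v (fun y => f (c y)) x = 'D_(v *m jacobian c x) f (c x).
Proof.
move=> dc df; rewrite deriveE; last exact: differentiable_comp.
rewrite (diff_comp dc df) /= -(deriveE _ df) -(deriveE _ dc).
by rewrite deriveEjacobian.
Qed.

Variables (W U U' : set V) (c : V -> V).
Hypotheses (oW : open W) (oU : open U) (oU' : open U').
Hypotheses (WU : forall x, W x -> U x) (WU' : forall x, W x -> U' (c x)).
Hypothesis sc : smooth_on W c.
Variables (g g' : V -> 'M[R]_d) (xi xi' : V -> V).
Hypotheses (sg' : smooth_mx U' g') (sxi' : smooth_mx U' xi').
Local Notation J := (jacobian c).
Hypothesis gJ : forall x, W x -> g x = J x *m g' (c x) *m (J x)^T.
Hypothesis xiJ : forall x, W x -> xi' (c x) = xi x *m J x.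

Lemma eta_col_pull x : W x -> eta_col g xi x = J x *m eta_col g' xi' (c x).
Proof.
by move=> Wx; rewrite /eta_col gJ // xiJ // trmx_mul !mulmxA.
Qed.

Lemma jacobian_entry x a b : W x ->
  J x a b = 'D_(basis_vec R a) (fun y => c y 0 b) x.
Proof.
move=> Wx; have dc := smooth_differentiable sc Wx.
by rewrite derive_entry // deriveEjacobian // /basis_vec -rowE [RHS]mxE.
Qed.

(** Differentiating [eta = J eta'] gives the tensorial term and the inhomogeneous term [S], which
    holds the second derivatives of the coordinate change. [S] is symmetric by [schwarz] and cancels
    in the antisymmetrisation. *)
Lemma half_deta_pull x : W x ->
  half_deta g xi x = J x *m half_deta g' xi' (c x) *m (J x)^T.
Proof.
move=> Wx; pose e' := eta_col g' xi'; pose cb b y := c y 0 b.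
have scb b : smooth_on W (cb b) by exact: smooth_entries.
have dc := smooth_differentiable sc Wx.
have de' b : differentiable (fun y => e' y b 0) (c x).
  exact: smooth_differentiable (smooth_eta_col oU' sg' sxi' b 0) (WU' Wx).
pose S : 'M[R]_d := \matrix_(i, a) \sum_b
  e' (c x) b 0 * 'D_(basis_vec R i) ('D_(basis_vec R a) (cb b)) x.
have ST : S^T = S.
  apply/matrixP => i a; rewrite !mxE; apply: eq_bigr => b _.
  by rewrite (schwarz _ _ oW (scb b) Wx).
have E : deta g xi x = J x *m deta g' xi' (c x) *m (J x)^T + S.
  apply/matrixP => i a; rewrite mxE.
  have -> : 'D_(basis_vec R i) (fun y => eta_col g xi y a 0) x
    = 'D_(basis_vec R i) (\sum_b (('D_(basis_vec R a) (cb b)) *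
        (fun y => e' (c y) b 0))) x.
    apply: (eq_derive_on oW) => // y Wy; rewrite eta_col_pull // mxE fct_sumE.
    by apply: eq_bigr => b _; rewrite jacobian_entry.
  have dDc b : differentiable ('D_(basis_vec R a) (cb b)) x.
    exact: smooth_differentiable (smooth_derive _ (scb b)) Wx.
  have dec b : differentiable (fun y => e' (c y) b 0) x.
    exact: (differentiable_comp dc (de' b)).
  rewrite derive_sum => [|b]; last first.
    by apply: derivableM; exact: diff_derivable.
  rewrite [RHS]mxE [X in _ = X + _]mxE [X in _ = _ + X]mxE -big_split.
  apply: eq_bigr => b _ /=.
  rewrite deriveM; [|exact: diff_derivable|exact: diff_derivable].
  congr (_ + _).
  have -> : 'D_(basis_vec R i) (fun y => e' (c y) b 0) x
      = 'D_(basis_vec R i *m J x) (fun y => e' y b 0) (c x).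
    exact: (derive_comp _ dc (de' b)).
  have Jab : J x a b = 'D_(basis_vec R a) (cb b) x := jacobian_entry a b Wx.
  rewrite -Jab (derive_basis _ (de' b)).
  rewrite [RHS]mulrC [X in _ = X * _]mxE; congr (_ * _).
  rewrite [RHS]mxE; apply: eq_bigr => l _.
  by rewrite /basis_vec -rowE; congr (_ * _); [rewrite mxE|rewrite [RHS]mxE].
have ET : (deta g xi x)^T = J x *m (deta g' xi' (c x))^T *m (J x)^T + S.
  by rewrite E [LHS]linearD /= ST !trmx_mul trmxK mulmxA.
rewrite /half_deta ET E opprD addrACA subrr addr0.
by rewrite -scalemxAr -scalemxAl mulmxBr mulmxBl.
Qed.

End Covariance.

(** * Global forms *)

Section Charts.
Variables (R : realType) (d : nat) (M : manifold R d).
Local Notation V := 'rV[R]_d.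

Lemma open_cim (i : mf_index M) : open (cim i).
Proof. exact: chart_im_open. Qed.

Lemma covl_cim (i j : mf_index M) x : covl i j x -> cim i x.
Proof. by move=> [p [pi _] <-]; exists p. Qed.

Lemma cchange_cim (i j : mf_index M) x : covl i j x -> cim j (cchange i j x).
Proof.
move=> [p [pi pj] <-]; exists p => //.
by rewrite /cchange /transition chart_mapK // inE.
Qed.

(** The overlap is the part of the range of [i] that the continuous inverse chart sends into the
    domain of [j]. *)
Lemma open_covl (i j : mf_index M) : open (covl i j).
Proof.
rewrite openE => x cx; have xi := covl_cim cx.
have nj : nbhs x (chart_inv (mf_atlas i) @^-1` chart_dom (mf_atlas j)).
  apply: (@chart_inv_cont _ _ _ (mf_atlas i) x).
    by rewrite inE; exact: xi.
  apply: open_nbhs_nbhs; split; first exact: chart_dom_open.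
  by case: cx => p [pi pj] <-; rewrite chart_mapK // inE.
have ni : nbhs x (cim i) by apply: open_nbhs_nbhs; split => //; exact: open_cim.
apply: filterS (filterI ni nj) => _ [[p pi <-]] /=.
by rewrite chart_mapK ?inE // => pj; exists p.
Qed.

End Charts.

(** * L, Lambda and P on global forms *)

Section SasakianForms.
Variables (R : realType) (n : nat) (M : sasakian R n).
Local Notation d := (n.*2.+1).
Local Notation V := 'rV[R]_d.
Local Notation C := R[i].
Local Notation I := (mf_index M).
Local Notation g := (sas_g M).
Local Notation xi := (sas_xi M).

Lemma smooth_g (i : I) : smooth_mx (cim i) (g i).
Proof. by apply: smooth_entries; [exact: open_cim|exact: met_smooth]. Qed.

Lemma smooth_xi (i : I) : smooth_mx (cim i) (xi i).
Proof. by apply: smooth_entries; [exact: open_cim|exact: vf_smooth]. Qed.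

Definition omega_mx (i : I) x : 'M[R]_d := half_deta (g i) (xi i) x.
Definition omega_sharp (i : I) x : 'M[R]_d :=
  invmx (g i x) *m omega_mx i x *m invmx (g i x).
Definition eta_vec (i : I) x : 'cV[R]_d := eta_col (g i) (xi i) x.

Lemma unitmx_g (i : I) x : cim i x -> g i x \in unitmx.
Proof. by apply: metric_unit => y; exact: met_pos. Qed.

Lemma sasakian_contact (i : I) x : cim i x ->
  contact_algebra n (omega_mx i x) (omega_sharp i x) (xi i x) (eta_vec i x).
Proof.
move=> ix; apply: (half_deta_contact (@open_cim _ _ _ i)) => //.
- exact: smooth_g.
- exact: met_sym.
- exact: met_pos.
- by move=> y iy; exact: smooth_differentiable (vf_smooth _ i) iy.
- exact: sas_killing.
- exact: sas_unit.
- exact: sas_phi2.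
Qed.

Lemma smooth_omega_mx (i : I) : smooth_mx (cim i) (omega_mx i).
Proof.
apply: smooth_half_deta; [exact: open_cim|exact: smooth_g|exact: smooth_xi].
Qed.

Lemma smooth_omega_sharp (i : I) : smooth_mx (cim i) (omega_sharp i).
Proof.
have oc := @open_cim _ _ M i.
have sgi := smooth_invmx oc (@smooth_g i) (@unitmx_g i).
have := smooth_mul oc (smooth_mul oc sgi (@smooth_omega_mx i)) sgi.
exact.
Qed.

Lemma smooth_eta_vec (i : I) : smooth_mx (cim i) (eta_vec i).
Proof.
apply: smooth_eta_col; [exact: open_cim|exact: smooth_g|exact: smooth_xi].
Qed.

Section Change.
Variables (i j : I) (x : V).
Hypothesis cx : covl i j x.
Local Notation J := (cjac i j x).
Local Notation y := (cchange i j x).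

(** The metric law writes an invertible Gram matrix as a product of square matrices containing
    [J]. *)
Lemma unit_cjac : J \in unitmx.
Proof.
have := unitmx_g (covl_cim cx); rewrite (met_transf _ cx) !unitmx_mul.
by case/andP => /andP[].
Qed.

Lemma omega_mx_change : omega_mx i x = J *m omega_mx j y *m J^T.
Proof.
apply: (half_deta_pull (@open_covl _ _ _ i j) (@open_cim _ _ _ j)) => //.
- by move=> z; exact: cchange_cim.
- exact: mf_compat.
- exact: smooth_g.
- exact: smooth_xi.
- by move=> z cz; exact: met_transf.
- by move=> z cz; exact: vf_transf.
Qed.

Lemma eta_vec_change : eta_vec i x = J *m eta_vec j y.
Proof.
rewrite /eta_vec /eta_col (met_transf _ cx) (vf_transf _ cx).
by rewrite trmx_mul !mulmxA.
Qed.

(** Inverting the metric law turns the covariant [omega_mx] into a contravariant tensor, the law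
    that [lam_pull] asks for. *)
Lemma omega_sharp_change : J^T *m omega_sharp i x *m J = omega_sharp j y.
Proof.
have uJ := unit_cjac; have uJT : J^T \in unitmx by rewrite unitmx_tr.
have uG := unitmx_g (cchange_cim cx).
have iG : invmx (g i x) = invmx J^T *m invmx (g j y) *m invmx J.
  have uGi := unitmx_g (covl_cim cx).
  apply: (can_inj (mulKmx uGi)); rewrite mulmxV // {1}(met_transf _ cx).
  by rewrite !mulmxA mulmxK // mulmxK // mulmxV.
rewrite /omega_sharp iG omega_mx_change !mulmxA mulmxV // mul1mx mulmxKV //.
by rewrite mulmxK // mulmxKV.
Qed.

End Change.

Local Notation field := (I -> V -> seq V -> C).
Implicit Types (F H : field).

(** [diff_form] transcribed to lists: the degree is a property of [F] instead of an index of its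
    type, so iterates of [L] and sums over [b] need no casts. *)
Record global_form k F : Prop := {
  gf_kform : forall i x, cim i x -> kform k (F i x);
  gf_smooth : forall i, smooth_form (cim i) (F i);
  gf_change : forall i j x, covl i j x ->
    F i x = pullback (cjac i j x) (F j (cchange i j x)) }.

Definition glef F : field := fun i x => lef (omega_mx i x) (F i x).
Definition glam F : field := fun i x => lam (omega_sharp i x) (F i x).
Definition gvert F : field := fun i x => vert (eta_vec i x) (xi i x) (F i x).

Lemma gform_lef k F : global_form k F -> global_form k.+2 (glef F).
Proof.
case=> kF sF cF; split.
- by move=> i x ix; exact: (kform_lef (sasakian_contact ix) (kF i x ix)).
- by move=> i; apply: smooth_form_lef;
    [exact: open_cim|exact: smooth_omega_mx|].
- move=> i j x cx; apply: funext => s.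
  by rewrite /glef (cF i j x cx) (omega_mx_change cx) lef_pull.
Qed.

Lemma gform_lam k F : global_form k.+2 F -> global_form k (glam F).
Proof.
case=> kF sF cF; split.
- move=> i x ix; have [mF aF hF] := kF i x ix.
  by split; [exact: multilinear_lam|exact: alternating_lam
    |exact: homogeneous_lam].
- by move=> i; apply: smooth_form_lam;
    [exact: open_cim|exact: smooth_omega_sharp|].
- move=> i j x cx; apply: funext => s.
  have [mF _ _] := kF j _ (cchange_cim cx).
  by rewrite /glam (cF i j x cx) lam_pull // omega_sharp_change.
Qed.

Lemma gform_vert k F : global_form k F -> global_form k (gvert F).
Proof.
case=> kF sF cF; split.
- move=> i x ix; have [mF aF hF] := kF i x ix.
  by split; [exact: multilinear_vert|exact: alternating_vert
    |exact: homogeneous_vert].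
- move=> i; apply: smooth_form_vert; [exact: open_cim|exact: smooth_eta_vec
    |exact: smooth_xi|exact: sF|].
  by move=> x ix; have [] := kF i x ix.
- move=> i j x cx; apply: funext => s.
  rewrite /gvert (cF i j x cx) (eta_vec_change cx).
  by rewrite vert_pull (vf_transf _ cx).
Qed.

Lemma gformD k F H (r : R) : global_form k F -> global_form k H ->
  global_form k (fun i x s => F i x s + r%:C * H i x s).
Proof.
case=> kF sF cF [kH sH cH]; split.
- move=> i x ix; have [mF aF hF] := kF i x ix; have [mH aH hH] := kH i x ix.
  split=> [s1 u v t s2|s1 u s2|s sk].
  + by rewrite mF mH; ring.
  + by rewrite aF aH mulr0 addr0.
  + by rewrite hF // hH // mulr0 addr0.
- move=> i s; apply: csmoothD; [exact: open_cim|exact: sF|].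
  by apply: csmoothZ; [exact: open_cim|exact: smooth_cst|exact: sH].
- by move=> i j x cx; apply: funext => s; rewrite (cF i j x cx) (cH i j x cx).
Qed.

Lemma gform0 k : global_form k (fun _ _ _ => 0).
Proof.
split=> //.
- by move=> i x _; split=> // s1 u v t s2; rewrite mulr0 addr0.
- by move=> i s; exact: csmooth0.
Qed.

Lemma gform_sum k (T : Type) (r : seq T) (P : pred T) (a : T -> R)
    (H : T -> field) : (forall t, P t -> global_form k (H t)) ->
  global_form k (fun i x s => \sum_(t <- r | P t) (a t)%:C * H t i x s).
Proof.
move=> gH; elim: r => [|t r IH].
  rewrite [X in global_form _ X](_ : _ = fun _ _ _ => 0); first exact: gform0.
  by apply: funext => i; apply: funext => x; apply: funext => s;
    rewrite big_nil.
rewrite [X in global_form _ X](_ : _ = fun i x s =>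
  \sum_(t <- r | P t) (a t)%:C * H t i x s
  + (if P t then a t else 0)%:C * (if P t then H t else fun _ _ _ => 0) i x s).
  by apply: gformD IH _; case: ifP => [/gH //|_]; exact: gform0.
apply: funext => i; apply: funext => x; apply: funext => s.
by rewrite big_cons; case: (P t); rewrite ?mulr0 ?addr0 // addrC.
Qed.

Lemma gform_iter_lef k j F : global_form k F ->
  global_form (j.*2 + k)%N (iter j glef F).
Proof. by move=> gF; elim: j => //= j IH; exact: gform_lef. Qed.

Lemma iter_glef j F i x :
  iter j glef F i x = iter j (lef (omega_mx i x)) (F i x).
Proof. by elim: j => //= j IH; rewrite /glef IH. Qed.

End SasakianForms.

Section IterLinear.
Variables (R : rcfType) (d : nat) (O : 'M[R]_d).
Implicit Types (F G : seq 'rV[R]_d -> R[i]).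

Lemma iter_lefD j F G (x : R[i]) s :
  iter j (lef O) (fun t => F t + x * G t) s
  = iter j (lef O) F s + x * iter j (lef O) G s.
Proof.
elim: j s => //= j IH s; rewrite -lefD; congr lef.
by apply: funext => t; exact: IH.
Qed.

Lemma iter_lefZ j F (x : R[i]) s :
  iter j (lef O) (fun t => x * F t) s = x * iter j (lef O) F s.
Proof.
elim: j s => //= j IH s; rewrite -lefZ; congr lef.
by apply: funext => t; exact: IH.
Qed.

End IterLinear.

(** * Decomposition of eigenforms of P *)

Section Decomposition.
Variables (R : realType) (n : nat) (M : sasakian R n).
Local Notation d := (n.*2.+1).
Local Notation V := 'rV[R]_d.
Local Notation C := R[i].
Local Notation I := (mf_index M).
Local Notation field := (I -> V -> seq V -> C).
Local Notation xi := (sas_xi M).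
Implicit Types (F : field).

Definition eigen (e : R) F := forall (i : I) x, cim i x ->
  vert (eta_vec i x) (xi i x) (F i x) = fun s => e%:C * F i x s.

(** The eigenvalue travels through the induction: [Lambda] commutes with [P], so [Lambda F] and its
    components have the same [e], and the weight of each component is a number. *)
Lemma decomposition (e : R) m F : global_form m F -> eigen e F ->
  exists p : nat -> field,
    (forall b, (b <= m./2)%N -> [/\
       global_form (m - b.*2)%N (p b), eigen e (p b) &
       forall (i : I) x, cim i x ->
         lam (omega_sharp i x) (p b i x) = fun=> 0]) /\
    (forall (i : I) x, cim i x -> forall s,
       F i x s = \sum_(b < m./2.+1) iter b (lef (omega_mx i x)) (p b i x) s).
Proof.
have [k mk] := ubnP m; elim: k m mk F => // k IH m mk F gF eF.
have [m2|] := ltnP m 2.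
  (* In degrees 0 and 1 the form is itself primitive, and the sum has the single term [b = 0]. *)
  exists (fun=> F); have -> : m./2 = 0%N by case: m m2 {mk gF} => [|[]].
  split=> [[|//] _|i x ix s]; last by rewrite big_ord1.
  rewrite subn0; split=> // i x ix; apply: funext => s.
  by apply: (lam_low _ _ m2); case: (gf_kform gF ix).
case: m mk gF => [|[|m]] // mk gF _.
have [||q [qP qE]] := IH m _ (glam F) (gform_lam gF).
- by rewrite -ltnS (leq_trans _ mk) // ltnS.
- move=> i x ix; have [mF aF hF] := gf_kform gF ix.
  apply: funext => s; rewrite /glam -(vert_lam (sasakian_contact ix)) // eF //.
  exact: lamZ.
(* By now [m] is the degree of [Lambda F], two less than that of [F]. [c b] is the constant of
   [lam_iter_lef] for [q b], of degree [m - 2b], with [j = b]. *)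
pose c b : R := b.+1%:R * (n%:R - m%:R + e + b%:R).
(* If [c b = 0], its inverse is 0 by convention and the term drops out. *)
pose p0 : field := fun i x s => F i x s + (-1)%:C * \sum_(b < m./2.+1)
  (c b)^-1%:C * iter b.+1 (@glef _ _ M) (q b) i x s.
have b2 (b : 'I_m./2.+1) : (b.*2 <= m)%N.
  by rewrite -[m in leqRHS]odd_double_half (leq_trans _ (leq_addl _ _)) //
    leq_double -ltnS.
have natr2B (b : 'I_m./2.+1) : (m - b.*2)%:R = m%:R - b%:R * 2 :> C.
  by rewrite natrB // -muln2 natrM.
have gp0 : global_form m.+2 p0.
  apply: gformD => //; apply: gform_sum => b _.
  have [gq _ _] := qP b (ltn_ord b).
  by have := gform_iter_lef b.+1 gq; rewrite doubleS !addSn subnKC.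
have p0E i x : cim i x -> p0 i x = fun s => F i x s + (-1)%:C *
    \sum_(b < m./2.+1) (c b)^-1%:C * iter b.+1 (lef (omega_mx i x)) (q b i x) s.
  move=> ix; apply: funext => s; rewrite /p0; congr (_ + _ * _).
  by apply: eq_bigr => b _; rewrite iter_glef.
have ep0 : eigen e p0.
  move=> i x ix; rewrite (p0E i x ix); apply: funext => s.
  rewrite vertD eF // mulrDr; congr (_ + _); rewrite mulrCA; congr (_ * _).
  have -> : vert (eta_vec i x) (xi i x)
      (fun s => \sum_(b < m./2.+1) (c b)^-1%:C *
      iter b.+1 (lef (omega_mx i x)) (q b i x) s) s
    = \sum_(b < m./2.+1) (c b)^-1%:C *
      vert (eta_vec i x) (xi i x) (iter b.+1 (lef (omega_mx i x)) (q b i x)) s.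
    by rewrite -ext_sum.
  rewrite mulr_sumr; apply: eq_bigr => b _.
  have [_ eq _] := qP b (ltn_ord b).
  by rewrite (vert_iter_lef (sasakian_contact ix) _ (eq i x ix)) mulrCA.
have lp0 i x : cim i x -> lam (omega_sharp i x) (p0 i x) = fun s =>
    \sum_(b < m./2.+1 | c b == 0) iter b (lef (omega_mx i x)) (q b i x) s.
  move=> ix; rewrite (p0E i x ix); apply: funext => s.
  rewrite lamD lam_sum [lam _ _ _]qE // rmorphN rmorph1 mulN1r -sumrB.
  rewrite [RHS]big_mkcond; apply: eq_bigr => b _.
  have [gq eq lq] := qP b (ltn_ord b).
  rewrite (lam_iter_lef (sasakian_contact ix) _ (gf_kform gq ix) (eq i x ix)).
  rewrite lq // iter_lef0 add0r natr2B.
  have -> : b.+1%:R * (n%:R - (m%:R - b%:R * 2) + e%:C - b%:R) = (c b)%:C.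
    rewrite /c rmorphM !rmorphD rmorphN !rmorph_nat; ring.
  rewrite mulrA -rmorphM; case: ifP => [/eqP ->|/negbT c0].
    by rewrite mulr0 mul0r subr0.
  by rewrite mulVf // mul1r subrr.
have lp00 i x : cim i x -> lam (omega_sharp i x) (p0 i x) = fun=> 0.
  move=> ix; have lE := lp0 i x ix.
  have [b0 cb0|c0] := pickP (fun b : 'I_m./2.+1 => c b == 0); last first.
    by rewrite lE; apply: funext => s; rewrite big1 // => b; rewrite c0.
  (* [n - m + e + b = 0] determines [b], so a single term survives in [lE]. *)
  have cb (b : 'I_m./2.+1) : (c b == 0) = (b == b0).
    apply/idP/eqP => [|-> //]; move: cb0; rewrite /c !mulf_eq0 !pnatr_eq0 /=.
    move=> /eqP e0 /eqP; rewrite -e0 => /addrI /eqP.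
    by rewrite eqr_nat => /eqP b_b0; exact: val_inj.
  have [gq eq lq] := qP b0 (ltn_ord b0).
  (* The weight of [q b0] is [b0], the situation of [lam_preimage_top]: not only [Lambda p0] but
     [p0] itself vanishes. *)
  suff -> : p0 i x = fun=> 0 by apply: funext => s; rewrite lam0.
  apply: (lam_preimage_top (sasakian_contact ix) (h := b0) (gf_kform gq ix)
    (eq i x ix) (lq i x ix) _ _ (ep0 i x ix)).
  - move: cb0; rewrite /c mulf_eq0 pnatr_eq0 /= => /eqP e0.
    have : (n%:R - m%:R + e + b0%:R)%:C = 0 by rewrite e0 rmorph0.
    rewrite natr2B !rmorphD rmorphN !rmorph_nat => e1.
    by rewrite -[RHS]add0r -[X in _ = X + _]e1; ring.
  - by rewrite subnKC //; exact: gf_kform gp0 _ _ ix.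
  - rewrite lE; apply: funext => s.
    by rewrite (eq_bigl _ _ cb) big_pred1_eq.
(* [p0] is the component at 0; the one at [b + 1] is the rescaled component of [Lambda F] at [b], of
   the same degree [m - 2b]. *)
exists (fun b => if b is b'.+1 then fun i x s => (c b')^-1%:C * q b' i x s
  else p0); split=> [[|b]|i x ix s].
- by rewrite subn0.
- rewrite ltnS => bm; have [gq eq lq] := qP b bm.
  have gZ : global_form (m - b.*2)%N (fun i x s => (c b)^-1%:C * q b i x s).
    have := gformD (c b)^-1 (gform0 M _) gq.
    by congr global_form; apply: funext => i; apply: funext => x;
      apply: funext => s;
      rewrite add0r.
  split=> //.
    move=> i x ix; apply: funext => s; rewrite /vert [LHS]extZ.
    rewrite -/(vert _ _ _ _) (eq i x ix); ring.
  by move=> i x ix; apply: funext => s; rewrite lamZ lq // mulr0.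
- rewrite big_ord_recl /= (p0E i x ix) rmorphN rmorph1 mulN1r.
  under [X in _ = _ + X]eq_bigr => b _ do rewrite -iterS iter_lefZ.
  by rewrite subrK.
Qed.

End Decomposition.

Lemma rows_castmx (R : realType) (d k k' : nat) (e : k = k')
  (A : 'M[R]_(k, d)) : rows (castmx (e, erefl d) A) = rows A.
Proof. by case: k' / e. Qed.

(** * Differential forms as fields of list forms *)

Section FormsAsFields.
Variables (R : realType) (n : nat) (M : sasakian R n).
Local Notation d := (n.*2.+1).

Definition list_field k (w : diff_form M k) (i : mf_index M) (x : 'rV[R]_d) :=
  list_form (w i x).

Lemma gform_list_field k (w : diff_form M k) : global_form k (list_field w).
Proof.
split=> [i x ix|i s|i j x cx].
- exact/kform_list_form/df_alt.
- rewrite /list_field /list_form; case: (size s == k); last exact: csmooth0.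
  exact: df_smooth.
- apply: funext => s; rewrite /pullback /list_field /list_form size_map.
  case: eqP => // sk; rewrite (df_transf _ cx); congr (w _ _ _).
  apply/row_matrixP => r; rewrite row_mul !rowK (nth_map (0 : 'rV[R]_d)) //.
  by rewrite sk.
Qed.

(** A sigma type, so that the family [wP] of the theorem is formed by projection. *)
Lemma diff_form_of_gform k F : global_form k F ->
  {w : diff_form M k | forall i x A, w i x A = F i x (rows A)}.
Proof.
move=> [kF sF cF].
have alt i x : cim i x -> altform (fun A : 'M[R]_(k, d) => F i x (rows A)).
  by move=> ix; have [mF aF _] := kF i x ix; exact: altform_rows.
have smo i (A : 'M[R]_(k, d)) :
    smooth_on (cim i) (fun x => complex.Re (F i x (rows A))) /\
    smooth_on (cim i) (fun x => complex.Im (F i x (rows A))).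
  exact: sF.
have tra i j x : covl i j x -> forall A : 'M[R]_(k, d),
    F i x (rows A) = F j (cchange i j x) (rows (A *m cjac i j x)).
  move=> cx A; rewrite (cF i j x cx) /pullback /jmap /rows -map_comp.
  by congr (F _ _ _); apply: eq_map => r /=; rewrite row_mul.
by exists (DiffForm alt smo tra).
Qed.

Lemma ext_deriv_omega_mx (i : mf_index M) x (B : 'M[R]_(2, d)) : cim i x ->
  2^-1 * ext_deriv (eta (sas_g M i) (sas_xi M i)) x B
  = (row ord0 B *m omega_mx i x *m (row ord_max B)^T) 0 0.
Proof.
apply: ext_deriv_eta; [exact: open_cim|exact: smooth_g|exact: smooth_xi].
Qed.

Lemma lefschetz_iter_rows (i : mf_index M) x k b F : cim i x -> kform k F ->
  forall A : 'M[R]_(b.*2 + k, d),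
  lefschetz_iter (b := b) (sas_g M i) (sas_xi M i) x
    (fun B : 'M[R]_(k, d) => F (rows B)) A
  = iter b (lef (omega_mx i x)) F (rows A).
Proof.
move=> ix kF; elim: b => [//|b IH] A.
have [mL aL hL] := kform_iter_lef (sasakian_contact ix) b kF.
have -> : lefschetz_iter (b := b.+1) (sas_g M i) (sas_xi M i) x
    (fun B : 'M[R]_(k, d) => F (rows B)) A
  = lefschetz (sas_g M i) (sas_xi M i) x
      (fun B : 'M[R]_(b.*2 + k, d) => iter b (lef (omega_mx i x)) F (rows B)) A.
  by congr lefschetz; apply: funext.
rewrite /lefschetz (wedge_lef (O := omega_mx i x)).
- by rewrite list_formK.
- exact: ca_skew (sasakian_contact ix).
- by move=> B; rewrite ext_deriv_omega_mx.
- exact: altform_rows.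
Qed.

Lemma primitive_lam k (w : diff_form M k) F : global_form k F ->
  (forall i x A, w i x A = F i x (rows A)) ->
  (forall (i : mf_index M) x, cim i x ->
    lam (omega_sharp i x) (F i x) = fun=> 0) ->
  primitive w.
Proof.
move=> gF wF lF i x ix A.
rewrite /Lambda (lambda_op_lam (O := omega_mx i x)).
- have -> : list_form (w i x) = F i x.
    have [_ _ hF] := gf_kform gF ix; rewrite -[RHS](list_formK hF).
    by congr list_form; apply: funext => B; rewrite wF.
  by rewrite [lam _ _]lF.
- exact: ca_skew (sasakian_contact ix).
- exact: met_sym.
- exact: unitmx_g.
- by move=> B; exact: ext_deriv_omega_mx.
- exact: df_alt.
Qed.

End FormsAsFields.

Theorem proposition18 (R : realType) (n : nat) (M : sasakian R n) (m : nat)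
    (w : diff_form M m) :
  exists wP : forall b : 'I_(m./2.+1), diff_form M (m - b.*2),
    (forall b, primitive (wP b)) /\
    (forall i x, cim i x -> forall A,
       w i x A = \sum_(b < m./2.+1) Lpow (lefschetz_degree b) (wP b) i x A).
Proof.
pose F := list_field w; have gF : global_form m F := gform_list_field w.
pose F1 := gvert F; have gF1 : global_form m F1 := gform_vert gF.
pose F0 i x s := F i x s + (-1)%:C * F1 i x s.
have gF0 : global_form m F0 by exact: gformD.
have idem i x : cim i x ->
    vert (eta_vec i x) (sas_xi M i x) (F1 i x) = F1 i x.
  move=> ix; have [_ aF _] := gf_kform gF ix.
  by apply: funext => s; exact: (vert_idem (sasakian_contact ix)).
have e1 : eigen 1 F1.
  by move=> i x ix; rewrite idem //; apply: funext => s; rewrite mul1r.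
have e0 : eigen 0 F0.
  move=> i x ix; apply: funext => s.
  rewrite [LHS]vertD idem // mul0r rmorphN rmorph1 mulN1r.
  by rewrite -/(F1 i x s) subrr.
have [p [pP pE]] := decomposition gF0 e0.
have [q [qP qE]] := decomposition gF1 e1.
(* Both parts have their components in the same degrees, and [Lambda] is linear, so the components
   are added. *)
pose r b i x s := p b i x s + 1%:C * q b i x s.
have gr (b : 'I_(m./2.+1)) : global_form (m - b.*2)%N (r b).
  have [gp _ _] := pP b (ltn_ord b); have [gq _ _] := qP b (ltn_ord b).
  exact: gformD.
exists (fun b => sval (diff_form_of_gform (gr b))); split=> [b|i x ix A].
  case: diff_form_of_gform => wb wbE /=; apply: (primitive_lam (gr b) wbE).
  have [_ _ lp] := pP b (ltn_ord b); have [_ _ lq] := qP b (ltn_ord b).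
  move=> i x ix; apply: funext => s.
  by rewrite [LHS]lamD lp // lq // mulr0 addr0.
have -> : w i x A = F0 i x (rows A) + 1%:C * F1 i x (rows A).
  by rewrite /F0 rmorphN rmorph1 mulN1r mul1r subrK; exact/esym/list_form_rows.
rewrite pE // qE // mulr_sumr -big_split; apply: eq_bigr => b _ /=.
case: diff_form_of_gform => wb wbE /=; rewrite /Lpow.
have -> : wb i x = fun B => r b i x (rows B) by apply: funext.
rewrite (lefschetz_iter_rows ix (gf_kform (gr b) ix)) iter_lefD.
by rewrite rows_castmx.
Qed.
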